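(* For every $k$-graph $F$ and $1\leq d<k$, we have $$\delta_d(\mathsf{T\text{-}Til}_F)=\max\left\{\delta_d(\mathsf{Til}_F),\ \delta_d(\mathsf{C\text{-}Cov}_F)\right\}.$$
   Context: A $k$-graph $G$ is a $k$-uniform hypergraph on a finite vertex set; $v(G),e(G)$ are its numbers of vertices and edges. The minimum $d$-degree $\delta_d(G)$ is the largest $\ell$ such that every $d$-subset of $V(G)$ is contained in at least $\ell$ edges. A homomorphism from $F$ to $G$ is a function $V(F)\to V(G)$ mapping edges of $F$ to edges of $G$. A perfect $F$-tiling of a vertex set is a set of vertex-disjoint copies of $F$ covering every vertex exactly once. $\delta_d(\mathsf{Til}_F)$ is the infimum over all $\delta\in[0,1]$ such that for all $\mu>0$ and all large enough $n$ divisible by $v(F)$, every $n$-vertex $k$-graph $G$ with $\delta_d(G)\geq(\delta+\mu)\binom{n-d}{k-d}$ has a perfect $F$-tiling. Given $k$-graphs $G_1,\dots,G_\ell$ on the same vertex set, an $\ell$-edge $k$-graph $J\subseteq G_1\cup\dots\cup G_\ell$ is transversal if its edges can be enumerated as $E(J)=\{e_1,\dots,e_\ell\}$ with $e_j\in G_j$ for every $1\leq j\leq\ell$. $\delta_d(\mathsf{T\text{-}Til}_F)$ is the infimum over all $\delta\in[0,1]$ such that for all $\mu>0$ and $n$ large enough, every collection of $k$-graphs $(G_1,\dots,G_{e(F)n})$ on the same $v(F)n$ vertices with $\delta_d(G_i)\geq(\delta+\mu)\binom{v(F)n-d}{k-d}$ for every $1\leq i\leq e(F)n$ has a transversal perfect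 $F$-tiling. For $k$-graphs $G_1,G_2$ on the same vertex set $V$, a colour covering homomorphism from $F$ to $(G_1,G_2)$ is a (not necessarily injective) function $\phi\colon V(F)\to V$ for which there is an edge $f\in F$ such that $\phi(f)\in G_1$ and $\phi$ is a homomorphism from $F'$ to $G_2$, where $F'$ is obtained from $F$ by deleting $f$ from its edge set. $\delta_d(\mathsf{C\text{-}Cov}_F)$ is the infimum over all $\delta\in[0,1]$ such that for all $\mu>0$ and $n$ large enough, any two $k$-graphs $G_1,G_2$ on the same $n$ vertices with $\delta_d(G_1),\delta_d(G_2)\geq(\delta+\mu)\binom{n-d}{k-d}$ admit a colour covering homomorphism from $F$ to $(G_1,G_2)$.
   Formalization: The k-graph F is assumed to have at least one edge; for an edgeless F no colour covering homomorphism exists, so its C-Cov threshold is 1 while the T-Til and Til thresholds are 0, and the equation fails. *)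

(* Defs.v *)
From HB Require Import structures.
From mathcomp Require Import all_boot all_order all_algebra.
From mathcomp Require Import all_classical all_reals.

Set Implicit Arguments.
Unset Strict Implicit.
Unset Printing Implicit Defensive.

Import Order.TTheory GRing.Theory Num.Theory.

Local Open Scope ring_scope.

Record kgraph (k : nat) (V : finType) := KGraph {
  edges : {set {set V}};
  edges_uniform : forall e : {set V}, e \in edges -> #|e| = k }.

Definition nverts k (V : finType) (G : kgraph k V) : nat := #|V|.

Definition nedges k (V : finType) (G : kgraph k V) : nat := #|edges G|.

Definition degree k (V : finType) (G : kgraph k V) (S : {set V}) : nat :=
  #|[set e in edges G | S \subset e]|.

(* Every degree is at most the number of edges, so the default value
   [nedges G] does not affect the minimum as soon as V has a d-subset. *)
Definition min_degree k (V : finType) (d : nat) (G : kgraph k V) : nat :=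
  \big[minn/nedges G]_(S : {set V} | #|S| == d) degree G S.

Lemma delete_edge_uniform k (V : finType) (G : kgraph k V) (f e : {set V}) :
  e \in (edges G :\ f)%SET -> #|e| = k.
Proof. by rewrite in_setD1 => /andP[_]; exact: edges_uniform. Qed.

Definition delete_edge k (V : finType) (G : kgraph k V) (f : {set V}) :
  kgraph k V := KGraph (@delete_edge_uniform k V G f).

Definition homomorphism k (U V : finType) (F : kgraph k U) (G : kgraph k V)
    (phi : U -> V) : Prop :=
  forall e : {set U}, e \in edges F -> (phi @: e)%SET \in edges G.

Definition colour_covering_hom k (U V : finType) (F : kgraph k U)
    (G1 G2 : kgraph k V) (phi : U -> V) : Prop :=
  exists f : {set U}, [/\ f \in edges F,
    (phi @: f)%SET \in edges G1 & homomorphism (delete_edge F f) G2 phi].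

(* A copy of F is a pair (vertex set, edge set), the image of F under an
   injection of its vertices. *)
Definition is_copy k (U V : finType) (F : kgraph k U)
    (C : {set V} * {set {set V}}) : Prop :=
  exists phi : U -> V, [/\ injective phi,
    C.1 = (phi @: [set: U])%SET
    & C.2 = [set (phi @: e)%SET | e : {set U} in edges F]%SET].

Definition perfect_tiling k (U V : finType) (F : kgraph k U)
    (T : {set {set V} * {set {set V}}}) : Prop :=
  [/\ forall C, C \in T -> is_copy F C,
      forall C D, C \in T -> D \in T -> C <> D -> [disjoint C.1 & D.1]
    & forall x : V, exists2 C, C \in T & x \in C.1].

Definition tiling_edges (V : finType) (T : {set {set V} * {set {set V}}}) :
  {set {set V}} := (\bigcup_(C in T) C.2)%SET.

Definition has_perfect_tiling k (U V : finType) (F : kgraph k U)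
    (G : kgraph k V) : Prop :=
  exists2 T, perfect_tiling F T & tiling_edges T \subset edges G.

Definition rainbow_transversal k (V : finType) l (G : 'I_l -> kgraph k V)
    (J : {set {set V}}) : Prop :=
  exists e : 'I_l -> {set V}, [/\ injective e,
    J = [set e j | j : 'I_l]%SET & forall j, e j \in edges (G j)].

Definition has_transversal_perfect_tiling k (U V : finType) (F : kgraph k U)
    l (G : 'I_l -> kgraph k V) : Prop :=
  exists2 T, perfect_tiling F T & rainbow_transversal G (tiling_edges T).

Definition dense_degree (R : realType) k (d : nat) (V : finType)
    (G : kgraph k V) (c : R) : Prop :=
  c * 'C(#|V| - d, k - d)%:R <= (min_degree d G)%:R.

Definition delta_Til (R : realType) k (d : nat) (U : finType)
    (F : kgraph k U) : R :=
  inf [set delta : R | 0 <= delta <= 1 /\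
    forall mu : R, 0 < mu -> exists n0 : nat, forall n : nat,
      (n0 <= n)%N -> (nverts F %| n)%N ->
      forall (V : finType) (G : kgraph k V), #|V| = n ->
        dense_degree d G (delta + mu) -> has_perfect_tiling F G]%classic.

Definition delta_TTil (R : realType) k (d : nat) (U : finType)
    (F : kgraph k U) : R :=
  inf [set delta : R | 0 <= delta <= 1 /\
    forall mu : R, 0 < mu -> exists n0 : nat, forall n : nat,
      (n0 <= n)%N ->
      forall (V : finType) (G : 'I_(nedges F * n) -> kgraph k V),
        #|V| = (nverts F * n)%N ->
        (forall i, dense_degree d (G i) (delta + mu)) ->
        has_transversal_perfect_tiling F G]%classic.

Definition delta_CCov (R : realType) k (d : nat) (U : finType)
    (F : kgraph k U) : R :=
  inf [set delta : R | 0 <= delta <= 1 /\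
    forall mu : R, 0 < mu -> exists n0 : nat, forall n : nat,
      (n0 <= n)%N ->
      forall (V : finType) (G1 G2 : kgraph k V), #|V| = n ->
        dense_degree d G1 (delta + mu) -> dense_degree d G2 (delta + mu) ->
        exists phi : U -> V, colour_covering_hom F G1 G2 phi]%classic.

(* Main.v *)
Require Import Defs.
From mathcomp Require Import all_boot all_order all_algebra.
From mathcomp Require Import reals.
From mathcomp Require Import zify ring lra.

(** Taking all colours equal, or one colour equal to G_1 and all others to G_2,
    shows that the transversal threshold is at least the two others.

    For the converse, split the vertex set into pieces of bounded size on each of
    which almost every colour inherits its relative minimum degree.  On a piece a
    colour has only boundedly many possible traces, so as long as many colours are
    unused, enough of them have the same trace, and the tiling threshold tiles the
    piece with these colours.  This greedy procedure uses all but a small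
    proportion of the colours.  A leftover colour can be exchanged for any colour
    of a finished piece on which it is dense: by the colour covering threshold,
    made injective by a blow-up argument, some copy of F in the piece uses the
    leftover colour on one edge and the common trace on the others, and the rest
    of the piece is tiled as before.  Hence, for each of the remaining pieces,
    colours with equal traces can be taken out of distinct finished pieces and
    replaced there by leftover colours.  For this, every colour has to be dense on
    most sets of a reservoir containing a positive proportion of the pieces; such
    a reservoir is chosen greedily with exponential weights. *)

Set Implicit Arguments.
Unset Strict Implicit.
Unset Printing Implicit Defensive.

Import Order.TTheory GRing.Theory Num.Theory.

(** * Degrees in induced subgraphs *)

(** The probability that a colour is sparse on a random set of bounded size is small, but it does
    not tend to 0 as the vertex set grows. Hence one cannot hope that a random partition has no bad
    piece: the partition is instead improved locally until every piece is good. For the same reason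
    the number [b] of colours that may be sparse on a good piece is linear in the number of pieces,
    so the greedy phase may leave a linear number of pieces unserved. Each of these consumes [q]
    reservoir pieces, where [q] is the number of colours per piece, which forces a reservoir of
    linear size and a [b] that is smaller by a factor of order [q]. All these requirements cost
    factors polynomial in the piece size [s.+1], while samples of size [s] fail with probability at
    most s^(-K) for any K fixed in advance and s large; this is what makes the constants compatible.
    If the piece size does not divide the number of vertices, the excess is removed beforehand by an
    incomplete tiling of one additional good set. *)

Definition uniform k (V : finType) (E : {set {set V}}) : Prop :=
  forall e : {set V}, e \in E -> #|e| = k.

Definition deg_in (V : finType) (E : {set {set V}}) (S T : {set V}) : nat :=
  #|[set e in E | (T \subset e) && (e \subset S)]|.

Lemma card_between (V : finType) (A B : {set V}) (k : nat) :
  A \subset B ->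
  #|[set e : {set V} | [&& A \subset e, e \subset B & #|e| == k]]| <=
    'C(#|B| - #|A|, k - #|A|).
Proof.
move=> AB; rewrite -[#|B| - _](cardsDS AB) -cards_draws.
rewrite -(card_in_imset (f := fun e => e :\: A)); last first.
  move=> e1 e2; rewrite !inE => /and3P[A1 _ _] /and3P[A2 _ _] E.
  by rewrite -(setID e1 A) -(setID e2 A) E (setIidPr A1) (setIidPr A2).
apply/subset_leq_card/fintype.subsetP => D /imsetP[e].
rewrite !inE => /and3P[Ae eB /eqP ek] ->.
by rewrite setSD // cardsDS // ek eqxx.
Qed.

(** Double counting of pairs of a vertex y outside T and an edge e inside S containing T and y: each
    such e has [k - #|T|] vertices outside T. *)
Lemma sum_deg_in k (V : finType) (E : {set {set V}}) (S T : {set V}) :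
  uniform k E ->
  \sum_(y in S | y \notin T) deg_in E S (y |: T) = (k - #|T|) * deg_in E S T.
Proof.
move=> Ek; rewrite /deg_in.
under eq_bigr => y _ do rewrite -sum1_card.
rewrite (exchange_big_dep [pred e in E | (T \subset e) && (e \subset S)]) /=; last first.
  move=> y e _; rewrite !inE subUset => /andP[-> /andP[/andP[_ ->] ->]] //.
rewrite mulnC -sum_nat_const; apply: eq_big => [e|e]; first by rewrite !inE.
case/andP=> eE /andP[Te eS]; rewrite -(Ek _ eE) -(cardsDS Te) -sum1_card.
apply: eq_bigl => y.
rewrite !inE; have [ye|ye] := boolP (y \in e).
    rewrite (fintype.subsetP eS) //= eE subUset sub1set ye Te eS /= ?andbT //.
by rewrite subUset sub1set (negPf ye) !andbF.
Qed.

Lemma card_bigcup_le (I V : finType) (P : pred I) (A : I -> {set V}) :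
  #|\bigcup_(i | P i) A i| <= \sum_(i | P i) #|A i|.
Proof.
elim/big_rec2: _ => [|i n B _ IH]; first by rewrite cards0.
by apply: leq_trans (leq_card_setU _ _) _; rewrite leq_add2l.
Qed.

(** Every edge that is lost contains T and one of the deleted vertices, and [card_between] bounds
    the number of edges through T and one fixed deleted vertex. *)
Lemma deg_in_del k (V : finType) (E : {set {set V}}) (S S' T : {set V}) :
  uniform k E -> T \subset S' -> S' \subset S -> #|T| < k ->
  deg_in E S T <= deg_in E S' T + #|S :\: S'| * 'C(#|S| - #|T|.+1, k - #|T|.+1).
Proof.
move=> Ek TS' S'S Tk; rewrite /deg_in.
set X := [set e in E | _]; set Y := [set e in E | _].
have: X \subset Y :|: \bigcup_(x in S :\: S')
    [set e : {set V} | [&& x |: T \subset e, e \subset S & #|e| == k]].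
  apply/fintype.subsetP => e; rewrite !inE => /andP[eE /andP[Te eS]].
  rewrite eE Te /=; have [//|/subsetPn[x xe xS']] := boolP (e \subset S').
  apply/bigcupP; exists x; first by rewrite !inE xS' (fintype.subsetP eS).
  by rewrite !inE subUset sub1set xe Te eS (Ek _ eE) /=.
move=> /subset_leq_card /leq_trans-> //.
apply: leq_trans (leq_card_setU _ _) _; rewrite leq_add2l.
apply: leq_trans (card_bigcup_le _ _) _.
rewrite -sum_nat_const; apply: leq_sum => x; rewrite !inE => /andP[xS' xS].
have xT : x \notin T by apply: contra xS'; apply: (fintype.subsetP TS').
have -> : #|T|.+1 = #|x |: T| by rewrite cardsU1 xT.
by apply: card_between; rewrite subUset sub1set xS (fintype.subset_trans TS').
Qed.

Local Open Scope ring_scope.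

(* The induced subgraph on [S] is never formed as a graph on a subtype here: [E] is
   a plain set of edges and [S] a set of vertices. *)
Definition dense_in (R : realFieldType) (k d : nat) (V : finType)
    (E : {set {set V}}) (S : {set V}) (a : R) : bool :=
  [forall T : {set V}, [&& #|T| == d & T \subset S] ==>
     (a * 'C(#|S| - d, k - d)%:R <= (deg_in E S T)%:R)].

Lemma dense_inP (R : realFieldType) k d (V : finType) (E : {set {set V}}) (S :
  {set V}) (a : R) :
  reflect (forall T : {set V}, #|T| = d -> T \subset S ->
      a * 'C(#|S| - d, k - d)%:R <= (deg_in E S T)%:R)
    (dense_in k d E S a).
Proof.
apply: (iffP forallP) => H T.
  by move=> Td TS; have := H T; rewrite Td TS eqxx.
by apply/implyP => /andP[/eqP Td TS]; apply: H.
Qed.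

(** Each deleted vertex costs at most a proportion (k-d)/(|S|-d) of the binomial coefficient by
    which degrees are normalised. *)
Lemma dense_in_del (R : realFieldType) k d (V : finType) (E : {set {set V}})
    (S S' : {set V}) (a mu : R) :
  uniform k E -> (d < k)%N -> 0 <= a -> 0 <= mu -> S' \subset S ->
  (d < #|S|)%N ->
  (#|S :\: S'| * (k - d))%:R <= mu * (#|S| - d)%:R ->
  dense_in k d E S (a + mu) -> dense_in k d E S' a.
Proof.
move=> Ek dk a0 mu0 S'S dS small /dense_inP H; apply/dense_inP => T Td TS'.
have {H} H := H T Td (fintype.subset_trans TS' S'S).
have Tk : (#|T| < k)%N by rewrite Td.
have := deg_in_del Ek TS' S'S Tk; rewrite Td -(ler_nat R) natrD natrM => D.
have B : ((#|S :\: S'| * 'C(#|S| - d.+1, k - d.+1))%:R : R) <=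
    mu * 'C(#|S| - d, k - d)%:R.
  have N0 : (0 : R) < (#|S| - d)%:R by rewrite ltr0n subn_gt0.
  have E2 : (k - d = (k - d.+1).+1)%N by rewrite subnSK.
  have := mul_bin_diag (#|S| - d) (k - d.+1); rewrite -E2 -subnS => E3.
  rewrite -(ler_pM2r N0) -natrM -mulnA (mulnC 'C(_, _)) E3 mulnA.
  by rewrite mulrAC natrM ler_wpM2r.
have C : a * 'C(#|S'| - d, k - d)%:R <= a * 'C(#|S| - d, k - d)%:R :> R.
  by rewrite ler_wpM2l // ler_nat leq_bin2l // leq_sub2r // subset_leq_card.
apply: (le_trans C); move: H B; rewrite natrM mulrDl; move: D.
lra.
Qed.

(** * Minimum degrees are inherited by random samples *)

Section Hoeffding.
Variables (R : realFieldType) (V : finType) (s : nat) (J : {set 'I_s}).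
Variable g : {ffun 'I_s -> V} -> V -> R.
Hypothesis g01 : forall w y, 0 <= g w y <= 1.
Hypothesis g_dep : forall w w' : {ffun 'I_s -> V},
  (forall i, i \in J -> w i = w' i) -> g w =1 g w'.
Hypothesis V_gt0 : (0 < #|V|)%N.
Variable gamma : R.
Hypothesis gamma01 : 0 < gamma <= 1.

Let avg w : R := (\sum_y g w y) / #|V|%:R.
Let theta := gamma / 4.
Let factor w y := 1 + theta * (avg w - g w y).
Let Phi w := \prod_(i in ~: J) factor w (w i).

Let n_gt0 : 0 < #|V|%:R :> R. Proof. by rewrite ltr0n. Qed.

Let avg01 w : 0 <= avg w <= 1.
Proof.
rewrite divr_ge0 ?ler0n ?sumr_ge0 //=; last by move=> y _; case/andP: (g01 w y).
rewrite ler_pdivrMr // mul1r -sum1_card natr_sum.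
by apply: ler_sum => y _; case/andP: (g01 w y).
Qed.

Let sum_factor w : \sum_y factor w y = #|V|%:R.
Proof.
rewrite big_split /= -mulr_sumr sumrB !sumr_const.
rewrite -(mulr_natr (avg w)) /avg divfK ?gt_eqF // subrr mulr0 addr0.
by [].
Qed.

Let merge (u w : {ffun 'I_s -> V}) := [ffun i => if i \in J then u i else w i].

(** With the coordinates in [J] fixed, [g] is fixed too, so the factors are independent and each has
    mean 1. To average over the other coordinates only, these are taken from a second tuple;
    exchanging the coordinates outside [J] is an involution on pairs of tuples. *)
Let sum_Phi : \sum_w Phi w = #|V|%:R ^+ s.
Proof.
have n_neq0 : #|V|%:R ^+ s != 0 :> R by rewrite expf_neq0 ?gt_eqF.
apply: (mulfI n_neq0).
have E1 : \sum_u \sum_w Phi (merge u w) = #|V|%:R ^+ s * #|V|%:R ^+ s.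
  have Eu u : \sum_w Phi (merge u w) = #|V|%:R ^+ s.
    pose F (i : 'I_s) y := if i \in J then 1 else factor u y.
    transitivity (\sum_(w : {ffun 'I_s -> V}) \prod_i F i (w i)).
      apply: eq_bigr => w _; rewrite /Phi (bigID (mem J)) /= [RHS](bigID (mem J)) /=.
      congr (_ * _).
        rewrite big1 ?big1 // => i; last by rewrite inE => /andP[/negP].
        by rewrite /F => ->.
      apply: eq_big => [i|i]; first by rewrite inE andbb.
      rewrite inE => /andP[_ iJ]; rewrite /F (negPf iJ) /merge ffunE (negPf iJ).
      have Em : g (merge u w) =1 g u by apply: g_dep => j jJ; rewrite ffunE jJ.
      by rewrite /factor /avg Em; under eq_bigr => y _ do rewrite Em.
    rewrite -bigA_distr_bigA /= (eq_bigr (fun=> #|V|%:R)).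
      by rewrite prodr_const card_ord.
    move=> i _; rewrite /F; case: (i \in J); last exact: sum_factor.
    by rewrite sumr_const.
  rewrite (eq_bigr _ (fun u _ => Eu u)) sumr_const card_ffun card_ord.
  rewrite -(mulr_natl (#|V|%:R ^+ s)).
  by rewrite natrX.
rewrite -E1 pair_big /=.
pose h (p : {ffun 'I_s -> V} * {ffun 'I_s -> V}) := (merge p.1 p.2, merge p.2 p.1).
have hK : involutive h.
  by case=> u w; rewrite /h /=; congr (_, _); apply/ffunP => i; rewrite !ffunE;
    case: (i \in J).
rewrite (reindex_inj (inv_inj hK)) /=.
transitivity (\sum_(p : {ffun 'I_s -> V} * {ffun 'I_s -> V}) Phi p.1).
  rewrite -(pair_big predT predT (fun u (w : {ffun 'I_s -> V}) => Phi u)) /=.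
  rewrite mulr_sumr; apply: eq_bigr => u _.
  by rewrite sumr_const card_ffun card_ord -(mulr_natl (Phi u)) natrX.
apply: eq_bigr => -[u w] _; congr Phi; apply/ffunP => i; rewrite /h /= !ffunE.
by case: (i \in J).
Qed.

(* Markov's inequality for [Phi], which has mean exactly 1; on the bad event AM-GM,
   applied to the inverses of the factors, bounds [Phi] below. *)
Lemma lower_tail :
  #|[set w : {ffun 'I_s -> V} |
      \sum_(i in ~: J) g w (w i) < ((\sum_y g w y) / #|V|%:R - gamma) * #|~: J|%:R]|%:R
  <= (1 - gamma ^+ 2 / 8) ^+ #|~: J| * #|V|%:R ^+ s :> R.
Proof.
have /andP[ga0 ga1] := gamma01.
have rho0 : 0 <= 1 - gamma ^+ 2 / 8 by nra.
rewrite -sum_Phi mulr_sumr -sum1_card natr_sum big_mkcond /=.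
(* For |u| <= gamma/4 the inverse of 1+u is at most 1 - u + gamma^2/8. On the bad event the average
   of u exceeds [theta * gamma], that is gamma^2/4, so the average inverse is at most 1 - gamma^2/8.
   This balance explains the choice of [theta]. *)
have f_bnd w y : 0 < factor w y /\
      (factor w y)^-1 <= 1 - theta * (avg w - g w y) + gamma ^+ 2 / 8.
  have /andP[a0 a1] := avg01 w; have /andP[b0 b1] := g01 w y.
  have f0 : 0 < factor w y by rewrite /factor /theta; nra.
  split=> //; rewrite -(ler_pM2r f0) mulVf ?gt_eqF // /factor.
  set u := theta * _; have u1 : `|u| <= gamma / 4.
    rewrite /u normrM ger0_norm /theta; last lra.
    by rewrite ler_piMr ?ler_norml; lra.
  move: u1; rewrite ler_norml => /andP[u1 u2].
  have uu : u ^+ 2 <= gamma ^+ 2 / 16 by nra.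
  have : (1 - u + gamma ^+ 2 / 8) * (1 + u) = 1 - u ^+ 2 + gamma ^+ 2 / 8 * (1 + u) by ring.
  move=> ->; have g2 : 0 <= gamma ^+ 2 / 8 by rewrite divr_ge0 ?sqr_ge0.
  have : gamma ^+ 2 / 8 * (3 / 4) <= gamma ^+ 2 / 8 * (1 + u) by rewrite ler_wpM2l //; lra.
  lra.
apply: ler_sum => w _; rewrite inE.
have Phi0 : 0 < Phi w by apply: prodr_gt0 => i _; case: (f_bnd w (w i)).
case: ifP => [fail|_]; last exact: mulr_ge0 (exprn_ge0 _ rho0) (ltW Phi0).
have [N0|N0] := posnP #|~: J|.
  by move: fail; rewrite N0 mulr0 (finset.cards0_eq N0) big_set0 ltxx.
rewrite -(ler_pM2r (_ : 0 < (Phi w)^-1)) ?invr_gt0 // mul1r mulfK ?gt_eqF //.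
rewrite /Phi -prodfV.
have NR : 0 < #|~: J|%:R :> R by rewrite ltr0n.
have [|AGM _] := @leif_AGM _ _ (mem (~: J)) (fun i => (factor w (w i))^-1).
  by move=> i _; rewrite invr_ge0 ltW //; case: (f_bnd w (w i)).
apply: (le_trans AGM).
rewrite lerXn2r ?nnegrE ?divr_ge0 ?ler0n //.
  by apply: sumr_ge0 => i _; rewrite invr_ge0 ltW //; case: (f_bnd w (w i)).
rewrite ler_pdivrMr //.
apply: (@le_trans _ _ (\sum_(i in ~: J) (1 - theta * (avg w - g w (w i)) + gamma ^+ 2 /
  8))).
  by apply: ler_sum => i _; case: (f_bnd w (w i)).
rewrite big_split sumrB -mulr_sumr sumrB !sumr_const /=.
rewrite -(mulr_natr (avg w)) -(mulr_natr (gamma ^+ 2 / 8)).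
move: fail; rewrite -/(avg w); set G := \sum_(i in _) _; set n := #|~: J|%:R.
rewrite /theta => fail.
have : gamma / 4 * G <= gamma / 4 * ((avg w - gamma) * n) by rewrite ler_wpM2l ?ltW //; lra.
lra.
Qed.

End Hoeffding.

Lemma set_cons (V : finType) (y : V) (l : seq V) :
  [set z in y :: l] = y |: [set z in l].
Proof. by apply/setP => z; rewrite !inE. Qed.

Section Sampling.
Variables (R : realFieldType) (k s : nat) (V : finType) (E : {set {set V}}).
Hypothesis Ek : uniform k E.

(* The proportion of the ordered [j]-tuples of vertices completing [l] to an edge,
   for the uniform distribution with repetitions. *)
Fixpoint density (j : nat) (l : seq V) : R :=
  if j is j'.+1 then (\sum_y density j' (y :: l)) / #|V|%:R
  else ([set y in l] \in E)%:R.

(* Number of ordered [j]-tuples of indices outside [I] whose values under [w]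
   complete [l] to an edge. *)
Fixpoint sample (w : {ffun 'I_s -> V}) (j : nat) (I : {set 'I_s}) (l : seq V) : R :=
  if j is j'.+1 then \sum_(i in ~: I) sample w j' (i |: I) (w i :: l)
  else ([set y in l] \in E)%:R.

Variable x : V.

(* A list over the sample [w] extended by the fixed vertex [x], given by its
   positions, where [None] stands for [x]. *)
Definition vals (w : {ffun 'I_s -> V}) (p : seq (option 'I_s)) : seq V :=
  [seq oapp w x o | o <- p].

Definition used (p : seq (option 'I_s)) : {set 'I_s} := [set i | Some i \in p].

(** The event of [lower_tail] for [J := used p]: averaged over one further sampled vertex,
    [density j] falls short of its true mean [density j.+1] by more than gamma. *)
Definition deviates (gamma : R) (j : nat) (p : seq (option 'I_s))
    (w : {ffun 'I_s -> V}) : bool :=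
  \sum_(i in ~: used p) density j (w i :: vals w p) <
    (density j.+1 (vals w p) - gamma) * #|~: used p|%:R.

Lemma used_cons i p : used (Some i :: p) = i |: used p.
Proof. by apply/setP => a; rewrite !inE. Qed.

Lemma card_used_le p : (#|used p| <= size p)%N.
Proof.
have -> : #|used p| = #|[set Some i | i in used p]|.
  by rewrite card_imset //; exact: Some_inj.
apply: leq_trans (card_size p).
by apply/subset_leq_card/subsetP => o /imsetP[i]; rewrite inE => ip ->.
Qed.

Lemma vals_eq (w w' : {ffun 'I_s -> V}) p :
  (forall i, i \in used p -> w i = w' i) -> vals w p = vals w' p.
Proof.
move=> H; apply/eq_in_map => -[i|] //= ip; apply: H; by rewrite inE.
Qed.

(** Unfolding [sample] by one index loses gamma in the density, as there is no deviation at that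
    level, and uses up one free index; the latter builds up the falling factorial. *)
Lemma sample_ge gamma m (w : {ffun 'I_s -> V}) : (m <= k)%N ->
  (forall j p, (j < m)%N -> size p = (k - j.+1)%N -> ~~ deviates gamma j p w) ->
  forall j p, (j <= m)%N -> size p = (k - j)%N ->
  (density j (vals w p) - j%:R * gamma) * ((s - #|used p|) ^_ j)%:R
    <= sample w j (used p) (vals w p).
Proof.
move=> mk H; elim=> [|j IH] p jm sp; first by rewrite mul0r subr0 mulr1.
have := H j p jm sp; rewrite -leNgt => Hp.
have cC : #|~: used p| = (s - #|used p|)%N by rewrite cardsCs setCK card_ord.
rewrite [sample _ _ _ _]/=.
apply: (@le_trans _ _ (\sum_(i in ~: used p)
    (density j (w i :: vals w p) - j%:R * gamma) * ((s - #|used p|).-1 ^_ j)%:R));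
      last first.
  apply: ler_sum => i; rewrite inE => iI.
  have := IH (Some i :: p); rewrite used_cons cardsU1 iI /= subnDA subn1.
  have -> : (s.-1 - #|used p| = (s - #|used p|).-1)%N by lia.
  by apply; [exact: ltnW | rewrite sp; lia].
rewrite -mulr_suml sumrB sumr_const cC ffactnS natrM mulrA ler_wpM2r ?ler0n //.
rewrite -(mulr_natr (j%:R * gamma)) -cC mulrS.
move: Hp; set a := density _ _; set N := #|_|%:R; set S := \sum_(i in _) _.
lra.
Qed.

(** The sampled vertices are distinct from each other and from [x], so an edge is counted at most
    once for each of the j! orders of its missing vertices. *)
Lemma sample_le (w : {ffun 'I_s -> V}) j p :
  injective w -> (forall i, w i != x) -> uniq p ->
  (j <= k)%N -> size p = (k - j)%N ->
  sample w j (used p) (vals w p) <=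
    (j`! * deg_in E (x |: [set w i | i : 'I_s]) [set y in vals w p])%:R.
Proof.
move=> winj wx; set S := _ |: _.
have oinj : injective (oapp w x).
  move=> [a|] [b|] //= => [/winj->//|H|H]; first by move/eqP: (wx a).
  by move/eqP: (wx b); rewrite H.
have vS q : [set y in vals w q] \subset S.
  apply/subsetP => y; rewrite inE => /mapP[[i|] _ ->] /=; rewrite !inE ?eqxx //.
  by rewrite imset_f ?orbT.
elim: j p => [|j IH] p up jk sp.
  rewrite mul1n ler_nat /=; case: (boolP (_ \in E)) => //= H.
  by rewrite card_gt0; apply/set0Pn; exists [set y in vals w p]; rewrite !inE H subxx vS.
rewrite [sample _ _ _ _]/=.
have valw i : (w i \in vals w p) = (Some i \in p).
  by rewrite /vals -[w i]/(oapp w x (Some i)) mem_map.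
apply: (@le_trans _ _ (\sum_(i in ~: used p)
   (j`! * deg_in E S (w i |: [set y in vals w p]))%:R)).
  apply: ler_sum => i; rewrite !inE => ip.
  have := IH (Some i :: p); rewrite used_cons /= set_cons; apply; rewrite ?ip //.
    exact: ltnW.
  by rewrite sp; lia.
rewrite -natr_sum ler_nat -big_distrr /= factS -mulnA.
rewrite [X in (_ <= X)%N]mulnCA leq_mul2l; apply/orP; right.
have cl : #|[set y in vals w p]| = (k - j.+1)%N.
  by rewrite cardsE (card_uniqP _) ?map_inj_uniq // size_map sp.
have -> : j.+1 = (k - #|[set y in vals w p]|)%N by rewrite cl; lia.
rewrite -(sum_deg_in _ _ Ek) -(big_imset (fun y =>
  deg_in E S (y |: [set z in vals w p]))) /=; last first.
  by move=> a b _ _ /winj.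
rewrite [X in (X <= _)%N]big_mkcond [X in (_ <= X)%N]big_mkcond /=.
apply: leq_sum => y _; case: ifP => // /imsetP[i]; rewrite !inE => ip ->.
by rewrite imset_f // orbT valw ip.
Qed.

Hypothesis V_gt0 : (0 < #|V|)%N.

Let n_gt0 : 0 < #|V|%:R :> R. Proof. by rewrite ltr0n. Qed.

Lemma density01 j l : 0 <= density j l <= 1.
Proof.
elim: j l => [|j IH] l /=; first by rewrite ler0n lern1 leq_b1.
rewrite divr_ge0 ?ler0n ?sumr_ge0 //=; last by move=> y _; case/andP: (IH (y :: l)).
rewrite ler_pdivrMr // mul1r -sum1_card natr_sum.
by apply: ler_sum => y _; case/andP: (IH (y :: l)).
Qed.

Lemma deviates_card gamma j p : 0 < gamma <= 1 ->
  #|[set w | deviates gamma j p w]|%:R <=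
    (1 - gamma ^+ 2 / 8) ^+ #|~: used p| * #|V|%:R ^+ s :> R.
Proof.
move=> g01.
have := @lower_tail R V s (used p) (fun w y => density j (y :: vals w p)).
apply=> // [w y|w w' H y]; first exact: density01.
by rewrite (vals_eq H).
Qed.

Lemma density_ge l j : uniq l -> (j <= k)%N -> size l = (k - j)%N ->
  (j`! * deg_in E setT [set y in l])%:R <= density j l * #|V|%:R ^+ j.
Proof.
elim: j l => [|j IH] l ul jk sl.
  rewrite mul1n expr0 mulr1 /= ler_nat.
  have sub : [set e in E | ([set y in l] \subset e) && (e \subset setT)] \subset
      [set [set y in l]].
    apply/subsetP => e; rewrite !inE => /andP[eE /andP[le _]].
    rewrite eq_sym eqEcard le /= (Ek eE) cardsE (card_uniqP ul) sl; lia.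
  case: (boolP (_ \in E)) => lE; first by rewrite (leq_trans (subset_leq_card sub)) ?cards1.
  rewrite leqn0 cards_eq0 -subset0; apply/subsetP => e eX.
  have := subsetP sub _ eX; rewrite inE => /eqP ee.
  by move: eX; rewrite inE ee (negPf lE).
rewrite exprS mulrA /= divfK ?gt_eqF // mulr_suml.
have cl : #|[set y in l]| = (k - j.+1)%N by rewrite cardsE (card_uniqP ul).
rewrite factS [(j.+1 * _)%N]mulnC -mulnA.
have -> : (j.+1 * deg_in E setT [set y in l] = (k - #|[set y in l]|) * deg_in E setT [set
  y in l])%N.
  by rewrite cl; congr muln; lia.
rewrite -(sum_deg_in _ _ Ek) big_distrr natr_sum /= big_mkcond /=.
apply: ler_sum => y _; rewrite !inE /=; case: ifP => yl.
  by rewrite -set_cons; apply: IH; rewrite /= ?yl ?sl //; lia.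
by rewrite mulr_ge0 ?exprn_ge0 //; case/andP: (density01 j (y :: l)).
Qed.

End Sampling.

(** Induction on K with r' = (1+rho)/2: the power r'^s absorbs K factors s, and (rho/r')^s the last
    one, because (1-b)^s (1+sb) <= 1 for b = 1 - rho/r'. *)
Lemma expr_geometric_bounded (R : realFieldType) (rho : R) (K : nat) :
  0 <= rho < 1 -> exists B, forall s : nat, s%:R ^+ K * rho ^+ s <= B.
Proof.
elim: K rho => [|K IH] rho /andP[r0 r1].
  by exists 1 => s; rewrite mul1r exprn_ile1 // ltW.
have [|B HB] := IH ((1 + rho) / 2); first by apply/andP; split; lra.
set r' := (1 + rho) / 2 in HB; have r'0 : 0 < r' by rewrite /r'; lra.
pose b := 1 - rho / r'.
have b0 : 0 < b by rewrite subr_gt0 ltr_pdivrMr // /r'; lra.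
have c0 : 0 <= rho / r' by rewrite divr_ge0 // ltW.
have lin s : s%:R * (rho / r') ^+ s <= b^-1.
  have : (rho / r') ^+ s * (1 + s%:R * b) <= 1.
    elim: s => [|s IHs]; first by rewrite mul0r addr0 mulr1.
    apply: le_trans IHs; rewrite exprSr -mulrA ler_wpM2l ?exprn_ge0 //.
    have -> : rho / r' = 1 - b by rewrite /b; ring.
    rewrite -natr1; have := ler0n R s; set t := s%:R => t0.
    have : 0 <= t * b ^+ 2 by rewrite mulr_ge0 // sqr_ge0.
    have : 0 <= b ^+ 2 by exact: sqr_ge0.
    lra.
  have := exprn_ge0 s c0; set z := (rho / r') ^+ s => z0 H.
  rewrite -(ler_pM2r b0) mulVf ?gt_eqF //; lra.
exists (B * b^-1) => s.
have -> : s%:R ^+ K.+1 * rho ^+ s = (s%:R ^+ K * r' ^+ s) * (s%:R * (rho / r') ^+ s).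
  have -> : rho ^+ s = r' ^+ s * (rho / r') ^+ s.
    by rewrite -exprMn mulrC divfK ?gt_eqF.
  by rewrite exprSr; ring.
by rewrite ler_pM // mulr_ge0 ?exprn_ge0 ?ler0n // ltW.
Qed.

(** The bound for the exponent K+1, divided by s. *)
Lemma expr_geometric_small (R : archiRealFieldType) (rho C : R) (K : nat) :
  0 <= rho < 1 -> exists s0, forall s : nat, (s0 <= s)%N -> C * s%:R ^+ K * rho ^+ s <= 1.
Proof.
move=> r01; have [B HB] := expr_geometric_bounded K.+1 r01.
exists (Num.bound (`|C| * `|B|)).+1 => s hs.
have s0 : 0 < s%:R :> R by rewrite ltr0n; apply: leq_trans hs.
have CB : `|C| * `|B| <= s%:R.
  apply: le_trans (ltW (archi_boundP _)) _; first by rewrite mulr_ge0.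
  by rewrite ler_nat; apply: leq_trans hs.
have r0 : 0 <= rho ^+ s by case/andP: r01 => r0 _; exact: exprn_ge0.
rewrite -(ler_pM2l s0) mulr1; apply: le_trans CB.
have -> : s%:R * (C * s%:R ^+ K * rho ^+ s) = C * (s%:R ^+ K.+1 * rho ^+ s).
  by rewrite exprS; ring.
apply: le_trans (ler_norm _) _; rewrite normrM ler_wpM2l //.
rewrite ger0_norm; last by apply: mulr_ge0 => //; exact: exprn_ge0 (ler0n _ _).
exact: le_trans (HB s) (ler_norm _).
Qed.

(* Bernoulli's inequality [n^m - (n-a)^m <= m a n^(m-1)], multiplied by [n]. *)
Lemma expn_sub_ge (n a m : nat) : (n ^ m * n <= (n - a) ^ m * n + m * a * n ^ m)%N.
Proof.
elim: m => [|m IH]; first by rewrite !expn0; lia.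
have [an|na] := leqP a n; last first.
  have -> : (n - a = 0)%N by lia.
  rewrite exp0n // mul0n add0n [X in (X <= _)%N]mulnC leq_mul2r; apply/orP; right.
  nia.
have E : (n = (n - a) + a)%N by lia.
rewrite !expnS; move: IH; move: (n - a)%N E => b E.
have : (b ^ m <= n ^ m)%N by case: (m) => // m'; rewrite leq_exp2r //; lia.
by move: (b ^ m)%N (n ^ m)%N => X Y; subst n; nia.
Qed.

Lemma expn_sub_le_ffact (n k d m : nat) : (m <= k - d)%N -> ((n - k) ^ m <= (n - d) ^_ m)%N.
Proof.
elim: m => // m IH hm; rewrite expnSr ffactnSr leq_mul //; last by lia.
by apply: IH; lia.
Qed.

Lemma leq_ffact2l (n1 n2 m : nat) : (n1 <= n2)%N -> (n1 ^_ m <= n2 ^_ m)%N.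
Proof.
by move=> n12; rewrite -(bin_ffact n1) -(bin_ffact n2) leq_mul2r leq_bin2l ?orbT.
Qed.

Section Inheritance.
Variables (R : archiRealFieldType) (k d : nat).
Hypothesis d_lt_k : (d < k)%N.
Variables (a mu : R).
Hypotheses (a_ge0 : 0 <= a) (mu_gt0 : 0 < mu).

(** Of the loss mu/2, a part mu/4 pays for powers instead of falling factorials in V, mu/8 for the
    deviations at the k-d levels, and mu/8 for [s - d] instead of [s.+1 - d] available indices in
    the sample. The fixed vertex [x] is needed since later every sample has to be built around a
    prescribed vertex. *)
Lemma dense_of_sample (s : nat) (V : finType) (E : {set {set V}}) (x : V)
    (w : {ffun 'I_s -> V}) (gamma : R) :
  uniform k E -> injective w -> (forall i, w i != x) ->
  (forall j p, (j < k - d)%N -> size p = (k - j.+1)%N ->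
     ~~ deviates E x gamma j p w) ->
  (k - d)%:R * gamma <= mu / 8 ->
  (a + 5 * mu / 8) * (k - d)%:R <= mu / 8 * (s.+1 - d)%:R ->
  (a + mu) * ((k - d) * k)%:R <= mu / 4 * #|V|%:R ->
  dense_in k d E setT (a + mu) ->
  dense_in k d E (x |: [set w i | i : 'I_s]) (a + mu / 2).
Proof.
move: a_ge0 mu_gt0 => a0 mu0; have b0 : 0 < a + 5 * mu / 8 by lra.
move=> Ek winj wx wdev gsmall sbig nbig /dense_inP HE; apply/dense_inP.
set S := _ |: _ => T Td TS; set m := (k - d)%N.
have n0 : (0 < #|V|)%N by apply/card_gt0P; exists x.
have oinj : injective (oapp w x).
  move=> [i|] [j|] //= => [/winj->//|H|H]; first by move/eqP: (wx i).
  by move/eqP: (wx j); rewrite H.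
pose p := enum [set o | oapp w x o \in T].
have Tp : [set y in vals x w p] = T.
  apply/setP => y; rewrite inE; apply/mapP/idP => [[o]|yT].
    by rewrite mem_enum inE => oT ->.
  have := subsetP TS _ yT; rewrite !inE => /orP[/eqP yx|/imsetP[i _ yi]].
    by exists None => //; rewrite mem_enum inE /= -yx.
  by exists (Some i) => //; rewrite mem_enum inE /= -yi.
have up : uniq p by exact: enum_uniq.
have uv : uniq (vals x w p) by rewrite map_inj_uniq.
have sv : size (vals x w p) = d by rewrite -Td -Tp cardsE (card_uniqP uv).
have sp : size p = d by rewrite -sv size_map.
have mk : (m <= k)%N by exact: leq_subr.
have kd : d = (k - m)%N by rewrite subKn // ltnW.
have cS : #|S| = s.+1.
  rewrite /S cardsU1 card_imset // card_ord.
  by case: imsetP => // -[i _ xi]; move: (wx i); rewrite xi eqxx.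
have ds : (d <= s.+1)%N by rewrite -Td -cS subset_leq_card.
have := sample_le R Ek winj wx up mk (etrans sp kd); rewrite Tp -/S.
have := sample_ge mk wdev (leqnn m) (etrans sp kd).
move=> /le_trans H /H {H}.
have : (m`! * deg_in E setT T)%:R <= density R E m (vals x w p) * #|V|%:R ^+ m.
  by rewrite -Tp; apply: density_ge Ek _ _ _ uv mk _ => //; rewrite sv.
have := HE T Td (subsetT _).
rewrite cS cardsT -/m.
set den := density _ _ _ _; set n := #|V|; set D := deg_in E setT T.
set DS := deg_in E S T.
move=> H1 H2 H3.
have nR : 0 < n%:R :> R by rewrite ltr0n.
have f0 : 0 < m`!%:R :> R by rewrite ltr0n fact_gt0.
have Hden : a + 3 * mu / 4 <= den.
  have nm0 : 0 < n%:R ^+ m :> R by rewrite exprn_gt0.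
  rewrite -(ler_pM2r nm0); apply: le_trans H2.
  rewrite natrM; apply: le_trans (ler_wpM2l (ltW f0) H1).
  rewrite mulrCA -natrM [(_ * 'C(_, _))%N]mulnC bin_ffact.
  have low : ((n - k) ^ m <= (n - d) ^_ m)%N.
    exact: expn_sub_le_ffact.
  apply: le_trans (_ : (a + mu) * ((n - k) ^ m)%:R <= _); last first.
    by apply: ler_wpM2l; [rewrite addr_ge0 // ltW | rewrite ler_nat].
  have := expn_sub_ge n k m; rewrite -(ler_nat R) natrD !natrM !natrX.
  set X := n%:R ^+ m; set Y := (n - k)%:R ^+ m => HX.
  rewrite -(ler_pM2r nR); move: nbig; rewrite natrM => nbig.
  have /(ler_wpM2l (ltW nm0)) := nbig; rewrite -/X => nb.
  have am : 0 <= a + mu by rewrite addr_ge0 // ltW.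
  have /(ler_wpM2l am) := HX.
  lra.
rewrite -(ler_pM2l f0) -natrM mulrCA -natrM [(_ * 'C(_, _))%N]mulnC bin_ffact.
apply: le_trans H3.
have m0 : (0 < m)%N by rewrite subn_gt0.
have sd : (0 < s.+1 - d)%N.
  rewrite lt0n; apply/negP => /eqP sd0; move: sbig; rewrite sd0 mulr0 leNgt.
  by rewrite mulr_gt0 // ltr0n.
have E1 : (s.+1 - d = (s - d).+1)%N by rewrite subSn // -ltnS -subn_gt0.
have lowI : ((s - d) ^_ m <= (s - #|used p|) ^_ m)%N.
  by apply: leq_ffact2l; rewrite leq_sub2l // -sp card_used_le.
apply: le_trans (_ : (a + 5 * mu / 8) * ((s - d) ^_ m)%:R <= _); last first.
  apply: le_trans (_ : (a + 5 * mu / 8) * ((s - #|used p|) ^_ m)%:R <= _).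
    by rewrite ler_wpM2l ?ler_nat // ltW.
  rewrite ler_wpM2r ?ler0n //; move: gsmall Hden; rewrite -/m; lra.
have NR : 0 < (s.+1 - d)%:R :> R by rewrite ltr0n.
rewrite -(ler_pM2l NR) ![_%:R * (_ * _)]mulrCA -!natrM.
have := sbig; rewrite -/m => sb.
have mN : (m <= s.+1 - d)%N.
  rewrite -(ler_nat R) -(ler_pM2l b0); apply: le_trans sb _.
  by rewrite ler_wpM2r ?ler0n //; lra.
have EN : ((s.+1 - d) * (s - d) ^_ m = (s.+1 - d) ^_ m * (s.+1 - d - m))%N.
  by rewrite E1 -ffactnSr ffactnS.
rewrite EN !natrM (natrB _ mN).
set Y := ((s.+1 - d) ^_ m)%:R; set N := (s.+1 - d)%:R; set M := m%:R.
have /(ler_wpM2l (ler0n R _ : 0 <= Y)) := sb; rewrite -/N -/M.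
lra.
Qed.

(** Union bound over the events [deviates]. They are indexed by lists of positions in the sample
    instead of vertices, so there are at most k (s+1)^k of them, independently of V, whereas each
    has probability exponentially small in s. *)
Lemma dense_inherit (K : nat) :
  exists s0, forall s, (s0 <= s)%N ->
  exists n0, forall (V : finType) (E : {set {set V}}) (x : V),
    uniform k E -> (n0 <= #|V|)%N -> dense_in k d E setT (a + mu) ->
    (#|[set w : {ffun 'I_s -> V} | [&& injectiveb w, [forall i, w i != x] &
        ~~ dense_in k d E (x |: [set w i | i : 'I_s]) (a + mu / 2)]]| * s ^ K
      <= #|V| ^ s)%N.
Proof.
move: a_ge0 mu_gt0 => a0 mu0.
pose gamma : R := Num.min 1 (mu / (8 * k%:R)).
have k0 : 0 < k%:R :> R by rewrite ltr0n; lia.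
have g0 : 0 < gamma by rewrite lt_min ltr01 divr_gt0 // mulr_gt0.
have g1 : gamma <= 1 by rewrite ge_min lexx.
have gk : gamma * k%:R <= mu / 8.
  apply: le_trans (_ : mu / (8 * k%:R) * k%:R <= _).
    by rewrite ler_wpM2r ?ler0n // ge_min lexx orbT.
  by rewrite invfM mulrA divfK ?gt_eqF.
pose rho := 1 - gamma ^+ 2 / 8.
have rho0 : 0 < rho by rewrite /rho; nra.
have rho1 : rho < 1 by rewrite ltrBlDr ltrDl divr_gt0 // exprn_gt0.
pose C : R := k%:R * 2 ^+ k / rho ^+ k.
have [|s1 Hs1] := @expr_geometric_small _ rho C (k + K); first by rewrite rho1 ltW.
pose c2 : R := (a + 5 * mu / 8) * (k - d)%:R / (mu / 8).
exists (s1 + k + Num.bound c2).+1 => s hs.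
have [ks s1s cs] : [/\ (k <= s)%N, (s1 <= s)%N & (Num.bound c2 <= s.+1 - d)%N].
  by move: hs d_lt_k; move: (Num.bound c2) => c; clear=> hs dk; split; lia.
exists (Num.bound ((a + mu) * ((k - d) * k)%:R / (mu / 4))).+1 => V E x Ek nV HE.
have n0 : (0 < #|V|)%N by apply: leq_trans nV.
set Bad := [set w | _].
pose Dev (j : 'I_(k - d)) (p : (k - j.+1).-tuple (option 'I_s)) :=
  [set w | deviates E x gamma j p w].
have sub : Bad \subset \bigcup_(j : 'I_(k - d)) \bigcup_(p :
  (k - j.+1).-tuple (option 'I_s)) Dev j p.
  apply/subsetP => w; rewrite inE => /and3P[/injectiveP winj /forallP wx].
  apply: contraR => wU; apply: (@dense_of_sample s V E x w gamma) => //.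
  - move=> j p jm sp; apply: contra wU => dv.
    apply/bigcupP; exists (Ordinal jm) => //.
    have sp' : size p == (k - (Ordinal jm).+1)%N by rewrite sp.
    by apply/bigcupP; exists (Tuple sp') => //; rewrite inE.
  - rewrite mulrC; apply: le_trans gk; rewrite ler_wpM2l ?ler_nat ?leq_subr //.
    exact: ltW.
  - have mu8 : 0 < mu / 8 by lra.
    rewrite -ler_pdivrMl // mulrC -/c2.
    have c20 : 0 <= c2 by rewrite /c2 divr_ge0 ?mulr_ge0 ?ler0n //; lra.
    apply: le_trans (ltW (archi_boundP c20)) _; rewrite ler_nat.
    exact: cs.
  - have mu4 : 0 < mu / 4 by lra.
    rewrite -ler_pdivrMl // mulrC.
    apply: le_trans (ltW (archi_boundP _)) _.
      by rewrite divr_ge0 ?mulr_ge0 ?ler0n //; lra.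
    by rewrite ler_nat; exact: ltnW nV.
rewrite -(ler_nat R) natrM !natrX.
have n0R : 0 < #|V|%:R :> R by rewrite ltr0n.
have rhos : 0 < rho ^+ (s - k) by exact: exprn_gt0.
have devc j p : #|Dev j p|%:R <= rho ^+ (s - k) * #|V|%:R ^+ s.
  apply: le_trans (deviates_card _ _ n0 _ _ _) _; first by rewrite g0 g1.
  rewrite ler_wpM2r ?exprn_ge0 ?ler0n // -/rho.
  have cC : #|~: used p| = (s - #|used p|)%N by rewrite cardsCs setCK card_ord.
  rewrite ler_wiXn2l // ?(ltW rho0) ?(ltW rho1) // cC leq_sub2l //.
  by apply: leq_trans (card_used_le p) _; rewrite size_tuple leq_subr.
have Bc : #|Bad|%:R <= k%:R * s.+1%:R ^+ k * (rho ^+ (s - k) * #|V|%:R ^+ s) :> R.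
  apply: le_trans (_ : \sum_(j < k - d) \sum_(p :
    (k - j.+1).-tuple (option 'I_s)) #|Dev j p|%:R <= _).
    under eq_bigr => j _ do rewrite -natr_sum.
    rewrite -natr_sum ler_nat; apply: leq_trans (subset_leq_card sub) _.
    apply: leq_trans (card_bigcup_le _ _) _; apply: leq_sum => j _.
    exact: card_bigcup_le.
  apply: le_trans (_ : \sum_(j < k - d) s.+1%:R ^+ k * (rho ^+ (s - k) * #|V|%:R ^+ s) <=
    _).
    apply: ler_sum => j _.
    apply: le_trans (ler_sum _ (fun p _ => devc j p)) _.
    rewrite sumr_const -(mulr_natl (rho ^+ _ * _)) ler_wpM2r //.
      by rewrite mulr_ge0 ?exprn_ge0 ?ler0n // ltW.
    rewrite card_tuple card_option card_ord natrX ler_weXn2l ?leq_subr //.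
    by rewrite ler1n.
  rewrite sumr_const card_ord -(mulr_natl (s.+1%:R ^+ k * _)) -mulrA ler_wpM2r //.
    by rewrite !mulr_ge0 ?exprn_ge0 ?ler0n // ltW.
  by rewrite ler_nat leq_subr.
apply: le_trans (ler_wpM2r _ Bc) _; first by rewrite exprn_ge0.
rewrite mulrAC mulrA -[X in _ <= X]mul1r ler_wpM2r ?exprn_ge0 ?ler0n //.
apply: le_trans (Hs1 s s1s).
have -> : rho ^+ s = rho ^+ k * rho ^+ (s - k) by rewrite -exprD subnKC.
rewrite /C !exprD.
have -> : k%:R * 2 ^+ k / rho ^+ k * (s%:R ^+ k * s%:R ^+ K) * (rho ^+ k * rho ^+ (s - k))
  = (k%:R * (2 ^+ k * s%:R ^+ k) * s%:R ^+ K) * rho ^+ (s - k).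
  by field; rewrite expf_neq0 // gt_eqF.
rewrite mulrA.
apply: ler_wpM2r (ltW rhos) _ _ _; apply: ler_wpM2r; first exact: exprn_ge0.
rewrite -mulrA; apply: ler_wpM2l => //.
rewrite -exprMn lerXn2r ?nnegrE ?mulr_ge0 ?ler0n //.
rewrite -natrM ler_nat mul2n -addnn -addn1 leq_add2l.
by apply: leq_trans ks; apply: leq_ltn_trans d_lt_k.
Qed.

End Inheritance.

Local Close Scope ring_scope.

(** * Blow-ups of dense patterns *)

Lemma ffact_ge (n t : nat) : n ^ t * n <= n ^_ t * n + t * t * n ^ t.
Proof.
apply: leq_trans (expn_sub_ge n t t) _; rewrite leq_add2r leq_mul2r; apply/orP; right.
by have := @expn_sub_le_ffact n t 0 t; rewrite !subn0; apply.
Qed.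

Lemma card_tuple_cons (V : finType) (r : nat) (H : pred (seq V)) :
  #|[set w : r.+1.-tuple V | H w]| =
  \sum_(y : r.-tuple V) #|[set x | H (x :: y)]|.
Proof.
under [RHS]eq_bigr => y _ do rewrite -sum1_card.
rewrite -sum1_card (exchange_big_dep predT) //= (pair_big_dep predT (fun x (y :
  r.-tuple V) => x \in [set x0 | H (x0 :: y)])) /=.
pose h (p : V * r.-tuple V) := [tuple of p.1 :: p.2].
rewrite (reindex h) /=; first by apply: eq_bigl => -[x y]; rewrite !inE.
exists (fun w : r.+1.-tuple V => (thead w, [tuple of behead w])) => [[x y] _|w _].
  by congr (_, _); apply: val_inj.
by rewrite [RHS]tuple_eta; apply: val_inj.
Qed.

(* Averaging over the tuples [y] of large degree gives an injective [tau] all of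
   whose values extend a positive proportion of these [y]; then induct on [r]. *)
Lemma blowup_pred (r t q : nat) : 0 < q -> exists n0,
  forall (V : finType) (H : pred (seq V)), n0 <= #|V| ->
  #|V| ^ r <= q * #|[set w : r.-tuple V | H w]| ->
  exists2 A : 'I_r -> {set V}, forall i, #|A i| = t &
    forall w : r.-tuple V, (forall i, tnth w i \in A i) -> H w.
Proof.
elim: r q => [|r IH] q q0.
  exists 0 => V H _; rewrite expn0 => hH.
  exists (fun=> set0) => [[]//|w _].
  have /card_gt0P[u] : 0 < #|[set w : 0.-tuple V | H w]| by lia.
  by rewrite inE (tuple0 u) (tuple0 w).
(* One factor 2q for the proportion of tuples in [Y], t factors 2q for their degrees, and a factor 2
   for the non-injective maps [tau]. *)
pose q' := 2 * (2 * q) ^ t.+1.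
have q'0 : 0 < q' by rewrite /q' muln_gt0 expn_gt0; lia.
have [n1 Hn1] := IH q' q'0; exists (n1 + q' * t * t).+1 => V H nV.
set n := #|V| in nV *; have n0 : 0 < n by lia.
rewrite card_tuple_cons; pose dg (y : r.-tuple V) := #|[set x | H (x :: y)]|.
move=> Hsum; have {}Hsum : n ^ r.+1 <= q * \sum_y dg y by [].
pose Y := [set y : r.-tuple V | n <= 2 * q * dg y].
have dgn y : dg y <= n by exact: max_card.
have cY : n ^ r <= 2 * q * #|Y|.
  have : \sum_y 2 * q * dg y <= \sum_(y : r.-tuple V) (2 * q * n * (y \in Y) + n).
    apply: leq_sum => y _; rewrite inE; case: (leqP n (2 * q * dg y)) => h;
      last by rewrite muln0 add0n ltnW.
    by rewrite muln1; apply: leq_trans (leq_addr _ _); rewrite leq_mul2l dgn orbT.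
  rewrite -big_distrr big_split /= -big_distrr /= sum_nat_const card_tuple -/n.
  have -> : \sum_(y : r.-tuple V) (y \in Y) = #|Y|.
    by rewrite -sum1_card [RHS]big_mkcond /=; apply: eq_bigr => y _; case: (_ \in _).
  move=> S; rewrite -(leq_pmul2r n0); move: Hsum S.
  rewrite expnS; set Z := \sum_y dg y; move: (n ^ r) => X.
  have aux a b c e f : a * b <= c * e -> 2 * c * e <= 2 * c * a * f + b * a ->
      b * a <= 2 * c * f * a by clear; nia.
  exact: aux.
pose c (tau : {ffun 'I_t -> V}) := #|[set y : r.-tuple V | [forall i, H (tau i :: y)]]|.
have csum : n ^ r * n ^ t * 2 <= q' * \sum_tau c tau.
  have E : \sum_tau c tau = \sum_(y : r.-tuple V) dg y ^ t.
    transitivity (\sum_(tau : {ffun 'I_t -> V}) \sum_(y :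
      r.-tuple V | [forall i, H (tau i :: y)]) 1).
      by apply: eq_bigr => tau _; rewrite sum1_card /c cardsE.
    rewrite (exchange_big_dep predT) //=; apply: eq_bigr => y _.
    rewrite -[t in RHS]card_ord -card_ffun_on -sum1_card; apply: eq_bigl => tau.
    by apply/forallP/ffun_onP => h i; have := h i; rewrite inE.
  rewrite E /q' mulnC -mulnA leq_pmul2l //.
  apply: leq_trans (_ : (2 * q) ^ t.+1 * \sum_(y in Y) dg y ^ t <= _); last first.
    by rewrite leq_mul2l [X in _ <= X](bigID (mem Y)) /= leq_addr orbT.
  rewrite expnS -mulnA big_distrr /=.
  apply: leq_trans (_ : 2 * q * \sum_(y in Y) n ^ t <= _).
    by rewrite sum_nat_const mulnA leq_mul2r cY orbT.
  rewrite leq_mul2l; apply/orP; right; apply: leq_sum => y; rewrite inE => hy.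
  by rewrite -expnMn; case: (t) => // t'; rewrite leq_exp2r.
(* Only a proportion at most t^2/n of all maps is not injective, and each of them contributes at
   most [q' * n ^ r] to the sum in [csum]. As q' t^2 < n, they cannot use up the factor 2 there. *)
have [tau /injectiveP tinj htau] : exists2 tau :
  {ffun 'I_t -> V}, injectiveb tau & n ^ r <= q' * c tau.
  apply/exists_inP; apply: contraLR csum; rewrite negb_exists_in => /forall_inP small.
  rewrite -ltnNge big_distrr /= (bigID (fun tau : {ffun 'I_t -> V} => injectiveb tau)) /=.
  have cinj : #|[set f : {ffun 'I_t -> V} | injectiveb f]| = n ^_ t.
    by rewrite card_inj_ffuns card_ord.
  have h1 : \sum_(tau : {ffun 'I_t -> V} | injectiveb tau) q' * c tau <= n ^_ t * n ^ r.
    apply: leq_trans (_ : \sum_(tau : {ffun 'I_t -> V} | injectiveb tau) n ^ r <= _).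
      by apply: leq_sum; move=> tau /small; rewrite -ltnNge => /ltnW.
    by rewrite sum_nat_const -cinj cardsE.
  have h2 : \sum_(tau : {ffun 'I_t -> V} | ~~ injectiveb tau) q' * c tau <=
      (n ^ t - n ^_ t) * (q' * n ^ r).
    apply: leq_trans (_ : \sum_(tau :
      {ffun 'I_t -> V} | ~~ injectiveb tau) q' * n ^ r <= _).
      apply: leq_sum => tau _; rewrite leq_mul2l -[n in _ <= n ^ _]/(#|V|) -card_tuple
        max_card orbT //.
    rewrite sum_nat_const leq_mul2r -cinj; apply/orP; right.
    have -> : n ^ t = #|{: {ffun 'I_t -> V}}| by rewrite card_ffun card_ord.
    by rewrite -(cardC (mem [set f : {ffun 'I_t -> V} | injectiveb f])) addKn
      subset_leq_card //; apply/subsetP => f; rewrite !inE.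
  have h3 := ffact_ge n t; have h4 : q' * t * t < n by lia.
  have nt0 : 0 < n ^ t by rewrite expn_gt0 n0.
  have nr0 : 0 < n ^ r by rewrite expn_gt0 n0.
  apply: leq_ltn_trans (leq_add h1 h2) _.
  have aux X U Z m : 0 < X -> 0 < U -> Z <= U -> U * n <= Z * n + m * U ->
      q' * m < n -> Z * X + (U - Z) * (q' * X) < X * U * 2.
    move=> X0 U0 ZU; have UE : U = (U - Z) + Z by lia.
    rewrite {1 2 4}UE; rewrite {}UE in U0; move: (U - Z) U0 => W U0.
    rewrite mulnDl addnC leq_add2l => hW hm.
    have qW : q' * W < W + Z.
      rewrite -(ltn_pmul2r n0) -mulnA; apply: leq_ltn_trans (_ : q' * m * (W + Z) < _).
        by rewrite -mulnA leq_mul2l hW orbT.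
      by rewrite [X in _ < X]mulnC ltn_mul2r hm andbT.
    rewrite mulnA -mulnDl mulnC -mulnA ltn_pmul2l // [W * q']mulnC; lia.
  apply: (aux _ _ _ (t * t)) => //; last by rewrite mulnA.
  rewrite -cinj; have -> : n ^ t = #|{: {ffun 'I_t -> V}}| by rewrite card_ffun card_ord.
  exact: max_card.
have [|A' A't HA'] := Hn1 V (fun y => [forall i, H (tau i :: y)]) _ htau; first lia.
pose A (i : 'I_r.+1) := if unlift ord0 i is Some j then A' j else [set tau a | a : 'I_t].
exists A => [i|w wA].
  by rewrite /A; case: unliftP => [j _|_] //; rewrite card_imset // card_ord.
have := wA ord0; rewrite /A unlift_none => /imsetP[a _ wa].
have /HA'/forallP/(_ a) : forall j, tnth [tuple of behead w] j \in A' j.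
  move=> j; have := wA (lift ord0 j); rewrite /A liftK.
  by rewrite [w in tnth w _]tuple_eta tnthS.
by rewrite -wa /= -[X in H X -> _]/(val [tuple of thead w :: behead w]) -tuple_eta.
Qed.

Lemma min_degree_le k (V : finType) (d : nat) (G : kgraph k V) (T : {set V}) :
  #|T| = d -> min_degree d G <= degree G T.
Proof.
move=> Td; rewrite /min_degree.
elim: (index_enum _) (mem_index_enum T) => //= S r IH; rewrite inE big_cons.
case/predU1P => [<-|/IH {}IH]; first by rewrite Td eqxx geq_minl.
by case: ifP => // _; apply: leq_trans IH; rewrite geq_minr.
Qed.

Lemma degree_deg_in k (V : finType) (G : kgraph k V) (T : {set V}) :
  degree G T = deg_in (edges G) setT T.
Proof. by apply: eq_card => e; rewrite !inE subsetT andbT. Qed.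

(** * Induced subgraphs as graphs on a subtype *)

Section Induced.
Variables (k d : nat) (V : finType) (E : {set {set V}}) (S : {set V}).
Hypothesis Ek : uniform k E.

Definition induced : {set {set {x : V | x \in S}}} :=
  [set A : {set {x : V | x \in S}} | [set val x | x in A] \in E].

Lemma induced_uniform (A : {set {x : V | x \in S}}) : A \in induced -> #|A| = k.
Proof. by rewrite inE => /Ek; rewrite card_imset //; exact: val_inj. Qed.

Definition induced_kgraph : kgraph k {x : V | x \in S} := KGraph induced_uniform.

Lemma card_induced : #|{: {x : V | x \in S}}| = #|S|.
Proof. by rewrite card_sig; apply: eq_card => x; rewrite !inE. Qed.

Lemma val_imset_sub (A : {set {x : V | x \in S}}) : [set val x | x in A] \subset S.
Proof. by apply/subsetP => y /imsetP[x _ ->]; exact: valP. Qed.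

Lemma deg_induced (T : {set {x : V | x \in S}}) :
  deg_in induced setT T = deg_in E S [set val x | x in T].
Proof.
rewrite /deg_in -[LHS](card_imset _ (imset_inj val_inj)); apply: eq_card => B.
apply/imsetP/idP => [[A]|]; rewrite !inE.
  move=> /andP[AE /andP[TA _]] ->; rewrite AE val_imset_sub andbT /=.
  exact: imsetS.
case/andP=> BE /andP[TB BS]; pose A := [set x : {x : V | x \in S} | val x \in B].
have AB : B = [set val x | x in A].
  apply/setP => y; apply/idP/imsetP => [yB|[x]]; last by rewrite inE => xB ->.
  by exists (exist _ y (subsetP BS _ yB)); rewrite ?inE.
exists A => //; rewrite !inE -AB BE subsetT andbT /=.
by apply/subsetP => x xT; rewrite inE (subsetP TB) // imset_f.
Qed.

Local Open Scope ring_scope.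

Lemma dense_induced (R : realFieldType) (a : R) :
  dense_in k d E S a -> dense_in k d induced setT a.
Proof.
move=> /dense_inP H; apply/dense_inP => T Td _; rewrite deg_induced cardsT card_induced.
by apply: H; rewrite ?val_imset_sub // card_imset //; exact: val_inj.
Qed.

End Induced.

Local Open Scope ring_scope.

Lemma dense_degreeP (R : realFieldType) (k d : nat) (V : finType) (G : kgraph k V) (a : R) :
  (d < k)%N ->
  a * 'C(#|V| - d, k - d)%:R <= (min_degree d G)%:R <->
  dense_in k d (edges G) setT a.
Proof.
move=> dk; split=> [H|/dense_inP H].
  apply/dense_inP => T Td _; rewrite cardsT -degree_deg_in.
  by apply: le_trans H _; rewrite ler_nat min_degree_le.
rewrite cardsT in H.
rewrite /min_degree; elim/big_ind: _ => [|m n Hm Hn|T /eqP Td]; last 2 first.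
- by rewrite /minn; case: ifP.
- by rewrite degree_deg_in; apply: H.
(* What remains is the default value [nedges G] of the minimum. If d > |V|, the binomial coefficient
   vanishes because k-d > 0; otherwise some d-set exists, and its degree is at most the number of
   edges. *)
have [dV|dV] := leqP d #|V|; last first.
  have -> : (#|V| - d = 0)%N by apply/eqP; rewrite subn_eq0 ltnW.
  by rewrite bin0n subn_eq0 leqNgt dk mulr0 ler0n.
have [T /andP[_ /eqP Td]] : exists T : {set V}, (T \subset setT) && (#|T| == d).
  have : (0 < 'C(#|[set: V]|, d))%N by rewrite bin_gt0 cardsT.
  by rewrite -cards_draws => /card_gt0P[T]; rewrite inE => HT; exists T.
apply: le_trans (H T Td (subsetT _)) _; rewrite ler_nat /nedges.
by apply/subset_leq_card/subsetP => e; rewrite inE => /andP[].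
Qed.

Local Close Scope ring_scope.

(** * Tilings coloured bijectively *)

Section Tilings.
Variables (k : nat) (VF : finType) (F : kgraph k VF).
Hypothesis k_gt0 : 0 < k.
Hypothesis F_nonempty : 0 < nedges F.
Variable V : finType.

(** Ordering the copies of a tiling in a list makes it possible to use only the first few of
    them. *)
Fixpoint packs (E : {set {set V}}) (L : seq {ffun VF -> V}) (S : {set V}) : Prop :=
  if L is phi :: L' then
    [/\ injective phi, forall e, e \in edges F -> phi @: e \in E,
        phi @: setT \subset S & packs E L' (S :\: phi @: setT)]
  else S = set0.

Lemma packs_card E L S : packs E L S -> #|S| = #|VF| * size L.
Proof.
elim: L S => [|phi L IH] S /=; first by move=> ->; rewrite cards0 muln0.
case=> phi_inj _ sub /IH; rewrite cardsDS // card_imset // cardsT mulnS => <-.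
by have := subset_leq_card sub; rewrite card_imset // cardsT => /subnKC ->.
Qed.

Lemma tiling_packs (G : kgraph k V) :
  has_perfect_tiling F G -> exists L, packs (edges G) L setT.
Proof.
case=> T [Tcopy Tdis Tcov] Tedges.
suff H (l : seq ({set V} * {set {set V}})) : uniq l -> {subset l <= T} ->
    exists L, packs (edges G) L (\bigcup_(C in l) C.1).
  have [L HL] := H (enum T) (enum_uniq _) (fun C CT => etrans (esym (mem_enum _ _)) CT).
  exists L; suff -> : [set: V] = \bigcup_(C in enum T) C.1 by [].
  apply/setP => x; rewrite inE; apply/esym/bigcupP; have [C CT xC] := Tcov x.
  by exists C; rewrite ?mem_enum.
elim: l => [|C l IH] /=.
  by exists [::]; rewrite /= big_pred0.
case/andP=> Cl ul lT; have CT : C \in T by apply: lT; rewrite inE eqxx.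
have [L HL] := IH ul (fun D Dl => lT D (mem_behead (s := C :: l) Dl)).
have [phi [phi_inj C1 C2]] := Tcopy C CT.
have E1 : (finfun phi) @: setT = C.1 by rewrite C1; apply: eq_imset => y; rewrite ffunE.
exists (finfun phi :: L) => /=; rewrite E1; split.
- by move=> y z; rewrite !ffunE => /phi_inj.
- move=> e eF; apply: (subsetP Tedges); apply/bigcupP; exists C => //.
  rewrite C2; apply/imsetP; exists e => //; apply: eq_imset => y; by rewrite ffunE.
- by apply: bigcup_sup; rewrite inE eqxx.
suff -> : (\bigcup_(D in C :: l) D.1) :\: C.1 = \bigcup_(D in l) D.1 by [].
apply/setP => x; rewrite !inE; apply/andP/bigcupP => [[xC /bigcupP[D]]|[D Dl xD]].
  by rewrite inE => /orP[/eqP ->|Dl] xD; [rewrite xD in xC|exists D].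
split; last by apply/bigcupP; exists D; rewrite // inE Dl orbT.
have DT : D \in T by apply: lT; rewrite inE Dl orbT.
apply/negP => xC; have CD : C <> D by move=> CD; rewrite CD Dl in Cl.
by have := Tdis C D CT DT CD; rewrite disjoints_subset => /subsetP/(_ x xC); rewrite inE xD.
Qed.

Variables (C : finType) (G : C -> {set {set V}}).
Hypothesis Gk : forall c, uniform k (G c).

(* The vertex set [S] has a perfect [F]-tiling whose edges are coloured
   bijectively by the colour set [D]. *)
Inductive rainbow_tiled : {set V} -> {set C} -> Prop :=
| rainbow_tiled0 : rainbow_tiled set0 set0
| rainbow_tiledS (S : {set V}) (D : {set C}) (phi : VF -> V) (chi : {set VF} -> C) :
    injective phi -> {in edges F &, injective chi} ->
    (forall e, e \in edges F -> phi @: e \in G (chi e)) ->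
    [disjoint phi @: setT & S] -> [disjoint chi @: edges F & D] ->
    rainbow_tiled S D ->
    rainbow_tiled (phi @: setT :|: S) (chi @: edges F :|: D).

Lemma rainbow_tiledU (S1 S2 : {set V}) (D1 D2 : {set C}) :
  [disjoint S1 & S2] -> [disjoint D1 & D2] ->
  rainbow_tiled S1 D1 -> rainbow_tiled S2 D2 ->
  rainbow_tiled (S1 :|: S2) (D1 :|: D2).
Proof.
move=> dS dD T1 T2; elim: T1 dS dD => {S1 D1} [|S D phi chi pI cI pE dpS dcD _ IH] dS dD.
  by rewrite !set0U.
move: dS dD; rewrite -!setI_eq0 !setIUl !setU_eq0 => /andP[dS1 dS2] /andP[dD1 dD2].
rewrite -!setUA; apply: rainbow_tiledS => //.
- by rewrite -setI_eq0 setIUr setU_eq0 dS1 setI_eq0 dpS.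
- by rewrite -setI_eq0 setIUr setU_eq0 dD1 setI_eq0 dcD.
- by apply: IH; rewrite -setI_eq0.
Qed.

Lemma edges_choose (D : {set C}) : nedges F <= #|D| ->
  exists2 chi : {set VF} -> C, {in edges F &, injective chi} & chi @: edges F \subset D.
Proof.
move=> FD; have [c0 _] : exists c, c \in D by apply/card_gt0P/(leq_trans F_nonempty).
have lt e : e \in edges F -> index e (enum (edges F)) < #|D|.
  by move=> eF; apply: leq_trans FD; rewrite /nedges cardE index_mem mem_enum.
exists (fun e => nth c0 (enum D) (index e (enum (edges F)))).
  move=> e1 e2 H1 H2 /eqP; rewrite nth_uniq ?enum_uniq -?cardE ?lt // => /eqP.
  by apply: (index_inj set0); rewrite mem_enum.
by apply/subsetP => c /imsetP[e eF ->]; rewrite -mem_enum mem_nth // -cardE lt.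
Qed.

(** The set S' covered by the first r copies is fixed before the colours are. Since every colour of
    D contains all edges of E inside S, any bijection between D and the edges of these copies is
    suitable. *)
Lemma packs_rainbow_tiled E L (S : {set V}) r : packs E L S -> r <= size L ->
  exists2 S' : {set V}, S' \subset S /\ #|S'| = #|VF| * r &
    forall D : {set C}, #|D| = nedges F * r ->
      (forall c, c \in D -> forall e : {set V}, e \subset S -> e \in E -> e \in G c) ->
      rainbow_tiled S' D.
Proof.
elim: r L S => [|r IH] [|phi L] S //.
- move=> _ _; exists set0; first by rewrite sub0set cards0 muln0.
  by move=> D; rewrite muln0 => /eqP; rewrite cards_eq0 => /eqP -> _; constructor.
- move=> _ _; exists set0; first by rewrite sub0set cards0 muln0.
  by move=> D; rewrite muln0 => /eqP; rewrite cards_eq0 => /eqP -> _; constructor.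
case=> pI pE pS HL; rewrite ltnS => rL.
have [S' [S'S cS'] HS'] := IH L _ HL rL.
have dis : [disjoint phi @: setT & S'].
  rewrite disjoint_sym disjoints_subset; apply: subset_trans S'S _.
  by apply/subsetP => x; rewrite !inE => /andP[].
exists (phi @: setT :|: S') => [|D cD HD].
  split; first by rewrite subUset pS (subset_trans S'S) ?subsetDl.
  move: dis; rewrite -setI_eq0 => /eqP dis.
  by rewrite cardsU dis cards0 subn0 card_imset // cardsT cS' mulnS.
have [|chi cI cD'] := @edges_choose D; first by rewrite cD mulnS leq_addr.
have -> : D = chi @: edges F :|: (D :\: chi @: edges F).
  by rewrite -{1}(setID D (chi @: edges F)) (setIidPr cD').
constructor => //.
- move=> e eF; apply: (HD (chi e)); last exact: pE.
    by apply: (subsetP cD'); apply: imset_f.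
  by apply: subset_trans pS; apply: imsetS; apply: subsetT.
- by rewrite -setI_eq0 setIDA [X in X :\: _]setIC -setIDA setDv setI0.
apply: HS'; first by rewrite cardsDS // card_in_imset // cD mulnS -/(nedges F) addKn.
move=> c; rewrite inE => /andP[_ cD0] e eS; apply: HD => //.
by apply: subset_trans eS _; apply: subsetDl.
Qed.

(** The map [h] from colours to edges is injective across different copies because these are
    disjoint and edges are nonempty, which is where k > 0 enters. *)
Lemma rainbow_tiled_copies S D : rainbow_tiled S D ->
  exists T : {set {set V} * {set {set V}}}, exists h : C -> {set V},
  [/\ forall K, K \in T -> is_copy F K /\ K.1 \subset S,
      forall K K', K \in T -> K' \in T -> K <> K' -> [disjoint K.1 & K'.1],
      forall x, x \in S -> exists2 K, K \in T & x \in K.1,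
      {in D &, injective h} /\ tiling_edges T = h @: D &
      forall c, c \in D -> h c \in G c /\ h c \subset S].
Proof.
elim=> {S D} [|S D phi chi pI cI pE dS dD _ [T [h [Tc Td Tcov [hI hT] hG]]]].
  exists set0, (fun=> set0); split; try by move=> ?; rewrite inE.
  split; first by move=> ?; rewrite inE.
  by rewrite /tiling_edges big_set0 imset0.
pose K0 := (phi @: [set: VF], [set phi @: e | e : {set VF} in edges F]).
pose inv c := odflt set0 [pick e in edges F | chi e == c].
have invK e : e \in edges F -> inv (chi e) = e.
  move=> eF; rewrite /inv; case: pickP => [e' /andP[e'F /eqP]|/(_ e)] /=.
    exact: cI.
  by rewrite eF eqxx.
pose h' c := if c \in chi @: edges F then phi @: inv c else h c.
have h'chi e : e \in edges F -> h' (chi e) = phi @: e.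
  by move=> eF; rewrite /h' imset_f // invK.
have h'D c : c \in D -> h' c = h c.
  move=> cD; rewrite /h'; case: ifP => // cc.
  by move: dD; rewrite disjoints_subset => /subsetP/(_ c cc); rewrite inE cD.
have K0copy : is_copy F K0 by exists phi.
have K0T K : K \in T -> [disjoint K0.1 & K.1].
  move=> KT; rewrite disjoint_sym; apply: disjointWl (proj2 (Tc K KT)) _.
  by rewrite disjoint_sym.
have edis e c : e \in edges F -> c \in D -> phi @: e <> h c.
  move=> eF cD E; have [hc hS] := hG c cD.
  have : 0 < #|h c| by rewrite (Gk hc).
  case/card_gt0P => x xh; have xS := subsetP hS _ xh.
  move: xh; rewrite -E => /imsetP[y _ xy].
  move: dS; rewrite disjoints_subset => /subsetP/(_ x); rewrite xy imset_f // inE -xy xS.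
  by move/(_ isT).
exists (K0 |: T), h'; split.
- move=> K; rewrite !inE => /predU1P[->|/Tc[Kc KS]].
    by split=> //; apply: subsetUl.
  by split=> //; apply: subset_trans KS _; apply: subsetUr.
- move=> K K'; rewrite !inE => /predU1P[->|KT] /predU1P[->|K'T] //.
  + by move=> _; apply: K0T.
  + by move=> _; rewrite disjoint_sym; apply: K0T.
  + exact: Td.
- move=> x; rewrite inE => /orP[xK|/Tcov[K KT xK]].
    by exists K0; rewrite ?inE ?eqxx.
  by exists K; rewrite // inE KT orbT.
- split.
    move=> c c'; rewrite !inE => /orP[/imsetP[e eF ->]|cD] /orP[/imsetP[e' e'F ->]|c'D].
    + by rewrite !h'chi // => /(imset_inj pI) ->.
    + by rewrite h'chi // h'D // => /edis; case.
    + by rewrite h'chi // h'D // => /esym/edis; case.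
    + by rewrite !h'D //; apply: hI.
  rewrite /tiling_edges bigcup_setU big_set1 -/(tiling_edges T) hT imsetU; congr (_ :|: _).
    rewrite -imset_comp; apply: eq_in_imset => e eF /=; by rewrite h'chi.
  by apply: eq_in_imset => c cD; rewrite h'D.
move=> c; rewrite inE => /orP[/imsetP[e eF ->]|cD].
  rewrite h'chi //; split; first exact: pE.
  by apply: subset_trans (subsetUl _ _); apply: imsetS; apply: subsetT.
rewrite h'D //; have [hc hS] := hG c cD; split=> //.
by apply: subset_trans hS (subsetUr _ _).
Qed.

End Tilings.

(** * Consequences of the two thresholds *)

Definition Til_admissible (R : realType) k d (U : finType) (F : kgraph k U)
    (delta : R) : Prop :=
  (0 <= delta <= 1)%R /\
    forall mu : R, (0 < mu)%R -> exists n0 : nat, forall n : nat,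
      n0 <= n -> nverts F %| n ->
      forall (V : finType) (G : kgraph k V), #|V| = n ->
        dense_degree d G (delta + mu)%R -> has_perfect_tiling F G.

Definition CCov_admissible (R : realType) k d (U : finType) (F : kgraph k U)
    (delta : R) : Prop :=
  (0 <= delta <= 1)%R /\
    forall mu : R, (0 < mu)%R -> exists n0 : nat, forall n : nat,
      n0 <= n ->
      forall (V : finType) (G1 G2 : kgraph k V), #|V| = n ->
        dense_degree d G1 (delta + mu)%R -> dense_degree d G2 (delta + mu)%R ->
        exists phi : U -> V, colour_covering_hom F G1 G2 phi.

Lemma packs_val k (VF V : finType) (F : kgraph k VF) (E : {set {set V}}) (S : {set V})
    (L : seq {ffun VF -> {x : V | x \in S}}) (A : {set {x : V | x \in S}}) :
  packs F (induced E S) L A ->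
  packs F E [seq [ffun y => val ((phi : {ffun _ -> _}) y)] | phi <- L] [set val x | x in A].
Proof.
elim: L A => [|phi L IH] A /=; first by move=> ->; rewrite imset0.
case=> pI pE pA /IH H.
have im (e : {set VF}) : [set [ffun y0 =>
  val (phi y0)] y | y in e] = [set val x | x in phi @: e].
  by rewrite -imset_comp; apply: eq_imset => y; rewrite ffunE.
split.
- by move=> x y; rewrite !ffunE => /val_inj/pI.
- by move=> e eF; rewrite im; have := pE e eF; rewrite inE.
- by rewrite im; apply: imsetS.
suff -> : [set val x | x in A] :\: [set [ffun y0 => val (phi y0)] y | y in [set: VF]] =
  [set val x | x in A :\: phi @: setT] by [].
rewrite im; apply/setP => v; apply/setDP/imsetP => [[/imsetP[x xA ->] vn]|[x]].
  by exists x => //; rewrite inE xA andbT; apply: contra vn; apply: imset_f.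
rewrite inE => /andP[xn xA] ->; split; first exact: imset_f.
by rewrite (mem_imset _ _ val_inj).
Qed.

Lemma til_packs (R : realType) k d (VF : finType) (F : kgraph k VF) (delta mu : R) :
  d < k -> Til_admissible d F delta -> (0 < mu)%R -> 0 < #|VF| ->
  exists t0, forall t, t0 <= t -> forall (V : finType) (E : {set {set V}}) (S : {set V}),
    uniform k E -> #|S| = #|VF| * t -> dense_in k d E S (delta + mu)%R ->
    exists L, packs F E L S.
Proof.
move=> dk [_ H] mu0 v0; have [n0 Hn0] := H mu mu0.
exists n0 => t tn V E S Ek cS HS.
have tile : has_perfect_tiling F (induced_kgraph S Ek).
  apply: (Hn0 #|S|); last by apply/dense_degreeP => //; apply: dense_induced.
  - by rewrite cS; apply: leq_trans tn _; apply: leq_pmull.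
  - by rewrite cS /nverts dvdn_mulr.
  - exact: card_induced.
have [L HL] := tiling_packs tile.
exists [seq [ffun y => val ((phi : {ffun _ -> _}) y)] | phi <- L].
suff E1 : [set val x | x in [set: {x : V | x \in S}]] = S.
  by have := packs_val HL; rewrite E1.
apply/setP => x; apply/imsetP/idP => [[y _ ->]|xS]; first exact: valP.
by exists (exist _ x xS).
Qed.

Definition colour_cover k (VF V : finType) (F : kgraph k VF) (E1 E2 : {set {set V}})
    (f : {set VF}) (phi : VF -> V) : bool :=
  [&& f \in edges F, phi @: f \in E1 &
      [forall e : {set VF}, (e \in edges F) && (e != f) ==> (phi @: e \in E2)]].

Lemma colour_coverP k (VF V : finType) (F : kgraph k VF) (E1 E2 : {set {set V}})
    (f : {set VF}) (phi : VF -> V) :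
  reflect [/\ f \in edges F, phi @: f \in E1 &
      forall e, e \in edges F -> e != f -> phi @: e \in E2]
    (colour_cover F E1 E2 f phi).
Proof.
apply: (iffP and3P) => -[fF f1 H]; split=> //.
  by move=> e eF ef; have := forallP H e; rewrite eF ef.
by apply/forallP => e; apply/implyP => /andP[]; apply: H.
Qed.

Lemma eq_colour_cover k (VF V : finType) (F : kgraph k VF) (E1 E2 : {set {set V}})
    (f : {set VF}) (phi psi : VF -> V) :
  phi =1 psi -> colour_cover F E1 E2 f phi = colour_cover F E1 E2 f psi.
Proof.
move=> E; rewrite /colour_cover (eq_imset _ E); congr [&& _, _ & _].
by apply: eq_forallb => e; rewrite (eq_imset _ E).
Qed.

Lemma ccov_in (R : realType) k d (VF : finType) (F : kgraph k VF) (delta mu : R) :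
  d < k -> CCov_admissible d F delta -> (0 < mu)%R ->
  exists n0, forall (V : finType) (E1 E2 : {set {set V}}) (S : {set V}),
    uniform k E1 -> uniform k E2 -> n0 <= #|S| ->
    dense_in k d E1 S (delta + mu)%R -> dense_in k d E2 S (delta + mu)%R ->
    exists (phi : VF -> V) f, (forall y, phi y \in S) /\ colour_cover F E1 E2 f phi.
Proof.
move=> dk [_ H] mu0; have [n0 Hn0] := H mu mu0.
exists n0 => V E1 E2 S E1k E2k nS H1 H2.
have [||phi [f [fF f1 f2]]] :=
  Hn0 #|S| nS _ (induced_kgraph S E1k) (induced_kgraph S E2k) (card_induced S).
- by apply/dense_degreeP => //; apply: dense_induced.
- by apply/dense_degreeP => //; apply: dense_induced.
exists (val \o phi), f; split; first by move=> y; exact: valP.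
apply/colour_coverP; split=> //; first by move: f1; rewrite inE -imset_comp.
move=> e eF ef; have := f2 e; rewrite /= !inE ef eF => /(_ isT).
by rewrite -imset_comp.
Qed.

(** Vertices of F with the same image under [psi] get different vertices of the same class, which
    has room for all of F; the classes are disjoint since every transversal is duplicate-free. An
    edge of F meets each fibre of [psi] at most once, as its image still has k vertices, so on this
    edge [phi] agrees with a transversal of the classes. *)
Lemma colour_cover_blowup k (VF V : finType) (F : kgraph k VF) (E1 E2 : {set {set V}})
    (r : nat) (psi : VF -> 'I_r) (f : {set VF}) (A : 'I_r -> {set V}) :
  uniform k E1 -> uniform k E2 -> 0 < #|VF| -> (forall i, #|A i| = #|VF|) ->
  (forall w : r.-tuple V, (forall i, tnth w i \in A i) ->
     uniq w && colour_cover F E1 E2 f (fun y => tnth w (psi y))) ->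
  exists2 phi : VF -> V, injective phi & colour_cover F E1 E2 f phi.
Proof.
move=> E1k E2k VF0 cA HA.
have A_gt0 i : exists x, x \in A i by apply/card_gt0P; rewrite cA.
pose a i : V := xchoose (A_gt0 i).
have aA i : a i \in A i by exact: (xchooseP (A_gt0 i)).
have tuple_inj (w : r.-tuple V) : uniq w -> injective (tnth w).
  by move=> uw i j; rewrite !(tnth_nth (a i)) => /eqP;
    rewrite nth_uniq ?size_tuple // => /eqP/val_inj.
have Adisj i j x : x \in A i -> x \in A j -> i = j.
  move=> xi xj; pose w := [tuple if (l == i) || (l == j) then x else a l | l < r].
  have /HA/andP[/tuple_inj winj _] : forall l, tnth w l \in A l.
    move=> l; rewrite tnth_mktuple; have [->|li] := eqVneq l i; first by [].
    by have [->|lj] := eqVneq l j; [exact: xj|exact: aA].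
  by apply: winj; rewrite !tnth_mktuple !eqxx orbT.
have lt_rank y : enum_rank y < size (enum (A (psi y))) by rewrite -cardE cA.
pose phi y := nth (a (psi y)) (enum (A (psi y))) (enum_rank y).
have phiA y : phi y \in A (psi y) by rewrite -mem_enum mem_nth.
exists phi.
  move=> y z yz; have pyz : psi y = psi z by apply: (Adisj _ _ (phi y)) => //; rewrite yz.
  move: yz; rewrite /phi pyz => /eqP; rewrite nth_uniq ?enum_uniq -?pyz // ?{1}pyz //.
  by move/eqP/val_inj/enum_rank_inj.
pose w (e : {set VF}) := [tuple if [pick y in e | psi y == l] is Some y then phi y else a
  l | l < r].
have wA e l : tnth (w e) l \in A l.
  by rewrite tnth_mktuple; case: pickP => [y /andP[_ /eqP <-]|_].
have base := HA (w set0) (wA set0); case/andP: base => _ /colour_coverP[fF f1 f2].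
have psi_inj e : e \in edges F -> {in e &, injective psi}.
  move=> eF; have ck : #|[set tnth (w set0) (psi y) | y in e]| = #|e|.
    rewrite (edges_uniform eF); have [ef|ef] := eqVneq e f; first by rewrite ef (E1k _ f1).
    exact: E2k (f2 _ eF ef).
  by move/eqP/imset_injP: ck => H y z ye ze pyz; apply: H; rewrite // pyz.
have phi_w e : e \in edges F -> phi @: e = [set tnth (w e) (psi y) | y in e].
  move=> eF; apply: eq_in_imset => y ye; rewrite tnth_mktuple.
  case: pickP => [z /andP[ze /eqP/esym pyz]|/(_ y)]; last by rewrite ye eqxx.
  by rewrite (psi_inj e eF y z ye ze pyz).
apply/colour_coverP; split=> // [|e eF ef].
  by rewrite phi_w //; have /andP[_ /colour_coverP[]] := HA (w f) (wA f).
by rewrite phi_w //; have /andP[_ /colour_coverP[_ _]] := HA (w e) (wA e); apply.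
Qed.

(** Splitting off the first entry as the root translates the count of [dense_inherit] into one for
    duplicate-free tuples. *)
Lemma card_tuple_rooted (V : finType) (s : nat) (P : pred {set V}) :
  #|[set z : s.+1.-tuple V | uniq z && P [set x in z]]| <=
  \sum_x #|[set w : {ffun 'I_s -> V} | [&& injectiveb w, [forall i, w i != x] &
                                           P (x |: [set w i | i : 'I_s])]]|.
Proof.
rewrite -sum1_card (partition_big (fun z : s.+1.-tuple V => thead z) predT) //=.
apply: leq_sum => x _; rewrite sum1_card.
pose h (z : s.+1.-tuple V) := [ffun i : 'I_s => tnth z (lift ord0 i)].
rewrite -(card_in_imset (f := h)); last first.
  move=> z1 z2 /andP[_ /eqP z1x] /andP[_ /eqP z2x] /ffunP E.
  apply: eq_from_tnth => i; case: (unliftP ord0 i) => [j ->|->].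
    by have := E j; rewrite !ffunE.
  by rewrite -[LHS]/(thead z1) -[RHS]/(thead z2) z1x z2x.
apply/subset_leq_card/subsetP => w /imsetP[z zB ->].
have {zB} /andP[] : (z \in [set z :
  s.+1.-tuple V | uniq z && P [set x in z]]) && (thead z == x) by [].
rewrite !inE => /andP[uz Pz] /eqP zx.
have zinj : injective (tnth z).
  by move=> i j; rewrite !(tnth_nth x) => /eqP;
    rewrite nth_uniq ?size_tuple // => /eqP/val_inj.
have z0 : tnth z ord0 = x by rewrite -zx.
have -> : x |: [set h z i | i : 'I_s] = [set y in z].
  apply/setP => y; rewrite !inE; apply/orP/tnthP => [[/eqP->|/imsetP[i _ ->]]|[i ->]].
  - by exists ord0.
  - by exists (lift ord0 i); rewrite ffunE.
  case: (unliftP ord0 i) => [j ->|->]; last by left; rewrite z0.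
  by right; apply/imsetP; exists j; rewrite ?ffunE.
rewrite Pz andbT; apply/andP; split.
  by apply/injectiveP => i j; rewrite !ffunE => /zinj/lift_inj.
apply/forallP => i; rewrite ffunE -z0; apply/negP => /eqP/zinj/eqP.
by rewrite eq_sym (negPf (neq_lift _ _)).
Qed.

(* Most samples of constant size contain a colour covering homomorphism; the most
   frequent pattern of such homomorphisms is blown up. *)
Lemma ccov_injective (R : realType) k d (VF : finType) (F : kgraph k VF) (delta mu : R) :
  d < k -> CCov_admissible d F delta -> (0 < mu)%R -> 0 < #|VF| ->
  exists n0, forall (V : finType) (E1 E2 : {set {set V}}),
    uniform k E1 -> uniform k E2 -> n0 <= #|V| ->
    dense_in k d E1 setT (delta + mu)%R -> dense_in k d E2 setT (delta + mu)%R ->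
    exists f, exists2 phi : VF -> V, injective phi & colour_cover F E1 E2 f phi.
Proof.
move=> dk adm mu0 v0.
have mu20 : (0 < mu / 2)%R by rewrite divr_gt0.
have /andP[delta0 _] := proj1 adm.
have [n1 Hn1] := ccov_in dk adm mu20.
have [s0 Hs0] := dense_inherit dk delta0 mu0 2.
pose s := n1 + s0 + 2.
have [|n2 Hn2] := Hs0 s; first by rewrite /s; lia.
pose r := s.+1.
pose I := ({ffun VF -> 'I_r} * {set VF})%type.
(* Tuples with repetitions and tuples on which [E1], respectively [E2], is not dense make up at most
   a quarter of all tuples each. Some pattern in [I] therefore occurs on a proportion at least
   1/(4|I|). The quarter for the sparse tuples comes from the exponent 2 above and s^2 >= 4. *)
have [n3 Hn3] := @blowup_pred r #|VF| (4 * #|{: I}|).+1 isT.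
exists (n2 + n3 + 4 * r * r).+1 => V E1 E2 E1k E2k nV H1 H2; set n := #|V|.
have n0 : 0 < n by apply: leq_trans nV.
pose P (p : I) (z : r.-tuple V) :=
  uniq z && colour_cover F E1 E2 p.2 (fun y => tnth z (p.1 y)).
pose Bad E := [set z : r.-tuple V | uniq z && ~~ dense_in k d E [set x in z] (delta + mu
  / 2)%R].
have cBad E : uniform k E -> dense_in k d E setT (delta + mu)%R -> 4 * #|Bad E| <= n ^ r.
  move=> Ek HE.
  have := card_tuple_rooted s (fun S => ~~ dense_in k d E S (delta + mu / 2)%R).
  rewrite -/(Bad E) => /(leq_mul (leqnn 4))/leq_trans; apply.
  rewrite big_distrr /= expnS.
  apply: leq_trans (_ : \sum_(x : V) n ^ s <= _); last by rewrite sum_nat_const.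
  apply: leq_sum => x _; apply: leq_trans (Hn2 V E x Ek _ HE); last by lia.
  rewrite mulnC leq_mul2l; apply/orP; right.
  have s2 : 2 <= s by rewrite /s leq_addl.
  exact: (leq_mul s2 s2).
have cU : n ^ r * n <= #|[set z : r.-tuple V | uniq z]| * n + r * r * n ^ r.
  suff -> : #|[set z : r.-tuple V | uniq z]| = n ^_ r by exact: ffact_ge.
  rewrite -[n]cardsT -card_uniq_tuples; apply: eq_card => z; rewrite !inE.
  by case: uniq; rewrite ?andbF // andbT; apply/esym/allP => x _; exact: in_setT.
have good (z : r.-tuple V) :
  uniq z -> z \notin Bad E1 -> z \notin Bad E2 -> exists p, P p z.
  rewrite !inE => uz; rewrite uz /= !negbK => D1 D2.
  have [|phi [f [phiS cc]]] := Hn1 V E1 E2 [set x in z] E1k E2k _ D1 D2.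
    by rewrite cardsE (card_uniqP uz) size_tuple /r /s; lia.
  have zi y : exists i, phi y == tnth z i.
    by have := phiS y; rewrite inE => /tnthP[i ->]; exists i.
  exists ([ffun y => xchoose (zi y)], f); rewrite /P uz /=.
  rewrite -(eq_colour_cover _ _ _ _ (phi := phi)) // => y.
  by rewrite ffunE; apply/eqP; exact: (xchooseP (zi y)).
have cover : n ^ r <= #|[set z : r.-tuple V | ~~ uniq z]| + #|Bad E1| + #|Bad E2| +
    \sum_(p : I) #|[set z : r.-tuple V | P p z]|.
  rewrite -card_tuple -cardsT.
  apply: leq_trans (_ : #|[set z : r.-tuple V | ~~ uniq z] :|: Bad E1 :|: Bad E2 :|:
    \bigcup_(p : I) [set z : r.-tuple V | P p z]| <= _).
    apply/subset_leq_card/subsetP => z _; rewrite 3!in_setU [z \in finset _]inE.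
    have [uz|//] := boolP (uniq z); have [//|z1] := boolP (z \in Bad E1).
    have [//|z2] := boolP (z \in Bad E2); have [p Pp] := good z uz z1 z2.
    by apply/orP; right; apply/bigcupP; exists p; rewrite ?inE.
  apply: leq_trans (leq_card_setU _ _) _; apply: leq_add; last exact: card_bigcup_le.
  apply: leq_trans (leq_card_setU _ _) _; rewrite leq_add2r.
  exact: leq_card_setU.
have cNU : 4 * #|[set z : r.-tuple V | ~~ uniq z]| <= n ^ r.
  have := cardsC [set z : r.-tuple V | uniq z]; rewrite card_tuple -/n.
  have -> : ~: [set z : r.-tuple V | uniq z] = [set z :
    r.-tuple V | ~~ uniq z] by apply/setP => z; rewrite !inE.
  have nr : 4 * (r * r) <= n by rewrite mulnA; apply: leq_trans (ltnW nV); rewrite leq_addl.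
  move: cU nr; set a := #|_|; set b := #|_|; move: (n ^ r) (r * r) => X m hX nr EX.
  have : n * b <= m * X by nia.
  nia.
have nr0 : 0 < n ^ r by rewrite expn_gt0 n0.
have [p hp] : exists p : I, n ^ r <= (4 * #|{: I}|).+1 * #|[set z : r.-tuple V | P p z]|.
  apply/existsP; apply: contraT; rewrite negb_exists => /forallP small.
  have : \sum_(p : I) (4 * #|{: I}|).+1 * #|[set z : r.-tuple V | P p z]| <= \sum_(p :
    I) n ^ r.
    by apply: leq_sum => p _; have := small p; rewrite -ltnNge => /ltnW.
  rewrite -big_distrr /= sum_nat_const.
  move: cover cNU (cBad E1 E1k H1) (cBad E2 E2k H2) nr0.
  set a := #|_|; set b := #|_|; set c := #|_|; set S := \sum_p _; move: (n ^ r) #|_| => X q.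
  clear; nia.
pose H (l : seq V) := [exists z : r.-tuple V, (val z == l) && P p z].
have HP (z : r.-tuple V) : H z = P p z.
  by apply/existsP/idP => [[z' /andP[/eqP/val_inj ->]]|Pz] //; exists z; rewrite eqxx.
have [||A cA HA] := Hn3 V H; first by lia.
  by apply: leq_trans hp _; rewrite leq_mul2l subset_leq_card ?orbT //;
    apply/subsetP => z; rewrite !inE HP.
exists p.2; apply: (colour_cover_blowup (psi := p.1)) E1k E2k v0 cA _ => w /HA.
by rewrite HP.
Qed.

Lemma ccov_injective_in (R : realType) k d (VF : finType) (F : kgraph k VF) (delta mu : R) :
  d < k -> CCov_admissible d F delta -> (0 < mu)%R -> 0 < #|VF| ->
  exists n0, forall (V : finType) (E1 E2 : {set {set V}}) (S : {set V}),
    uniform k E1 -> uniform k E2 -> n0 <= #|S| ->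
    dense_in k d E1 S (delta + mu)%R -> dense_in k d E2 S (delta + mu)%R ->
    exists f, exists phi : VF -> V,
      [/\ injective phi, forall y, phi y \in S & colour_cover F E1 E2 f phi].
Proof.
move=> dk adm mu0 v0; have [n0 Hn0] := ccov_injective dk adm mu0 v0.
exists n0 => V E1 E2 S E1k E2k nS H1 H2.
have [|||||f [phi pI cc]] := Hn0 {x : V | x \in S} (induced E1 S) (induced E2 S).
- exact: induced_uniform E1k.
- exact: induced_uniform E2k.
- by rewrite card_induced.
- exact: dense_induced.
- exact: dense_induced.
exists f, (val \o phi); split; first by move=> x y /val_inj/pI.
  by move=> y; exact: valP.
move/colour_coverP: cc => [fF f1 f2]; apply/colour_coverP; split=> //.
  by move: f1; rewrite inE -imset_comp.
by move=> e eF ef; have := f2 e eF ef; rewrite inE -imset_comp.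
Qed.

Section Pieces.
Variables (R : realType) (k d : nat) (VF : finType) (F : kgraph k VF) (delta mu : R).
Hypotheses (F_nonempty : 0 < nedges F) (d_lt_k : d < k).
Hypotheses (HT : Til_admissible d F delta) (HC : CCov_admissible d F delta).
Hypothesis mu_gt0 : (0 < mu)%R.

Let k_gt0 : 0 < k. Proof. exact: leq_ltn_trans d_lt_k. Qed.

Lemma VF_gt0 : 0 < #|VF|.
Proof.
case/card_gt0P: F_nonempty => e eF.
have : 0 < #|e| by rewrite (edges_uniform eF).
by move/leq_trans; apply; exact: max_card.
Qed.

Lemma mono_rainbow_tiled : exists t0, forall t, t0 <= t ->
  forall (V C : finType) (G : C -> {set {set V}}) (E : {set {set V}}) (S : {set V}),
    uniform k E -> #|S| = #|VF| * t -> dense_in k d E S (delta + mu)%R ->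
  forall r, r <= t -> exists2 S' : {set V}, S' \subset S /\ #|S'| = #|VF| * r &
    forall D : {set C}, #|D| = nedges F * r ->
      (forall c, c \in D -> forall e : {set V}, e \subset S -> e \in E -> e \in G c) ->
      rainbow_tiled F G S' D.
Proof.
have [t0 Ht0] := til_packs d_lt_k HT mu_gt0 VF_gt0.
exists t0 => t tt0 V C G E S Ek cS HS r rt.
have [L HL] := Ht0 t tt0 V E S Ek cS HS.
have sL : size L = t.
  by apply/eqP; rewrite -(eqn_pmul2l VF_gt0) -(packs_card HL) cS.
have [|S' HS1 HS2] := packs_rainbow_tiled F_nonempty G (r := r) HL; first by rewrite sL.
by exists S'.
Qed.

Lemma edges_choose_at (C : finType) (D : {set C}) (c : C) (f : {set VF}) :
  f \in edges F -> c \notin D -> nedges F <= #|D|.+1 ->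
  exists2 chi : {set VF} -> C, {in edges F &, injective chi} &
    chi f = c /\ forall e, e \in edges F -> e != f -> chi e \in D.
Proof.
move=> fF cD FD.
have lt e : e \in edges F -> e != f -> index e (enum (edges F :\ f)) < #|D|.
  move=> eF ef; apply: (@leq_trans #|edges F :\ f|).
    by rewrite [X in _ < X]cardE index_mem mem_enum !inE ef.
  by move: FD; rewrite /nedges (cardsD1 f) fF.
pose chi e := if e == f then c else nth c (enum D) (index e (enum (edges F :\ f))).
have chiD e : e \in edges F -> e != f -> chi e \in D.
  by move=> eF ef; rewrite /chi (negPf ef) -mem_enum mem_nth // -cardE lt.
exists chi; last by split=> //; rewrite /chi eqxx.
move=> e1 e2 H1 H2; have [->|n1] := eqVneq e1 f; have [->|n2] := eqVneq e2 f => //.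
- by rewrite {1}/chi eqxx => E; move: cD; rewrite E chiD.
- by rewrite {2}/chi eqxx => E; move: cD; rewrite -E chiD.
rewrite /chi (negPf n1) (negPf n2) => /eqP;
  rewrite nth_uniq ?enum_uniq -?cardE ?lt // => /eqP.
by apply: (index_inj set0); rewrite mem_enum !inE ?n1 ?n2.
Qed.

(** The covering threshold gives an injective copy of F in S with one edge in [G c] and the others
    in [E], and the colour [c] is spent on that edge. Removing these boundedly many vertices costs
    at most mu/2 in density, so the rest of S is still tiled inside [E]. *)
Lemma swap_rainbow_tiled : exists t0, forall t, t0 <= t ->
  forall (V C : finType) (G : C -> {set {set V}}) (E : {set {set V}}) (S : {set V})
    (c : C) (D : {set C}),
    (forall c, uniform k (G c)) -> uniform k E -> #|S| = #|VF| * t ->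
    dense_in k d E S (delta + mu)%R -> dense_in k d (G c) S (delta + mu)%R ->
    c \notin D -> #|D|.+1 = nedges F * t ->
    (forall c', c' \in D -> forall e : {set V}, e \subset S -> e \in E -> e \in G c') ->
    rainbow_tiled F G S (c |: D).
Proof.
have mu20 : (0 < mu / 2)%R by rewrite divr_gt0.
have /andP[delta0 _] := proj1 HT.
have [t1 Ht1] := til_packs d_lt_k HT mu20 VF_gt0.
have [n1 Hn1] := ccov_injective_in d_lt_k HC mu_gt0 VF_gt0.
have kd0 : (0 <= (#|VF| * (k - d))%:R / (mu / 2))%R by rewrite divr_ge0 ?ler0n // ltW.
pose N := Num.bound ((#|VF| * (k - d))%:R / (mu / 2))%R.
exists (t1 + n1 + d + N).+2 => t tt V C G E S c D Gk Ek cS HE Hc cD cardD HD.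
have tS : t <= #|S| by rewrite cS leq_pmull // VF_gt0.
have [|f [phi [pI pS /colour_coverP[fF f1 f2]]]] := Hn1 V (G c) E S (Gk c) Ek _ Hc HE.
  by apply: leq_trans tS; move: tt; clear; lia.
have phiS : phi @: setT \subset S by apply/subsetP => x /imsetP[y _ ->].
have cphi : #|phi @: setT| = #|VF| by rewrite card_imset // cardsT.
pose S2 := S :\: phi @: setT.
have cS2 : #|S2| = #|VF| * t.-1.
  rewrite cardsDS // cphi cS -{2}[#|VF|]muln1 -mulnBr subn1 //.
have SS2 : S :\: S2 = phi @: setT by rewrite setDDr setDv set0U; exact/setIidPr.
have HE2 : dense_in k d E S2 (delta + mu / 2)%R.
  apply: (dense_in_del Ek d_lt_k (mu := mu / 2) _ _ (subsetDl _ _)).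
  - by rewrite addr_ge0 // ltW.
  - exact: ltW.
  - by apply: leq_trans tS; move: tt; clear; lia.
  - rewrite SS2 cphi -ler_pdivrMl // mulrC.
    apply: le_trans (ltW (archi_boundP kd0)) _; rewrite ler_nat -/N.
    by move: tS tt; clear; lia.
  by rewrite -addrA -splitr.
have [|L HL] := Ht1 t.-1 _ V E S2 Ek cS2 HE2; first by move: tt; clear; lia.
have sL : size L = t.-1.
  by apply/eqP; rewrite -(eqn_pmul2l VF_gt0) -(packs_card HL) cS2.
have [|S' [S'S cS'] HS'] := packs_rainbow_tiled F_nonempty G (r := t.-1) HL;
  first by rewrite sL.
have eS' : S' = S2 by apply/eqP; rewrite eqEcard S'S cS' cS2 leqnn.
have [|chi chiI [chif chiD]] := edges_choose_at fF cD.
  by rewrite cardD leq_pmulr //; move: tt; clear; lia.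
have chiDD : chi @: edges F \subset c |: D.
  apply/subsetP => x /imsetP[e eF ->]; rewrite !inE.
  by have [->|ef] := eqVneq e f; rewrite ?chif ?eqxx // chiD ?orbT.
have -> : c |: D = chi @: edges F :|: ((c |: D) :\: chi @: edges F).
  by rewrite -{1}(setID (c |: D) (chi @: edges F)) (setIidPr chiDD).
have -> : S = phi @: setT :|: S2.
  by rewrite -{1}(setID S (phi @: setT)) (setIidPr phiS).
constructor => //.
- move=> e eF; have [->|ef] := eqVneq e f; first by rewrite chif.
  apply: (HD (chi e)); [exact: chiD| |exact: f2].
  by apply/subsetP => x /imsetP[y _ ->].
- by rewrite -setI_eq0 setIDA [X in X :\: _]setIC -setIDA setDv setI0.
- by rewrite -setI_eq0 setIDA [X in X :\: _]setIC -setIDA setDv setI0.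
rewrite -eS'; apply: HS'.
  rewrite cardsDS // card_in_imset // cardsU1 cD add1n cardD -/(nedges F).
  by rewrite -{2}[nedges F]muln1 -mulnBr subn1.
move=> c'; rewrite !inE => /andP[c'chi /orP[/eqP cc'|c'D]] e eS eE.
  by case/negP: c'chi; rewrite cc' -chif imset_f.
by apply: HD => //; apply: subset_trans eS (subsetDl _ _).
Qed.

End Pieces.

(** * Partitioning the vertices *)

Lemma bad_choice_card (T1 J : finType) (A : {set T1}) (bad : J -> pred T1) (b : nat) :
  (forall j, #|[set g in A | bad j g]| <= b) -> #|J| * b < #|A| ->
  exists2 g, g \in A & forall j, ~~ bad j g.
Proof.
move=> Hb lt.
have [g gA gU] : exists2 g, g \in A & g \notin \bigcup_j [set g in A | bad j g].
  apply/subsetPn; apply: contraL lt => /subset_leq_card sub; rewrite -leqNgt.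
  apply: leq_trans sub _; apply: leq_trans (card_bigcup_le _ _) _.
  by rewrite -sum_nat_const; apply: leq_sum => j _; exact: Hb.
exists g => // j; apply: contra gU => bj; apply/bigcupP; exists j => //.
by rewrite inE gA.
Qed.

Section Partition.
Variables (V : finType) (X : {set V}) (s N K : nat) (ok : pred {set V}).
Hypothesis cardX : #|X| = s.+1 * N.
Hypothesis rare : forall x, x \in X ->
  #|[set w : {ffun 'I_s -> V} | [&& injectiveb w, [forall i, w i != x],
      [forall i, w i \in X] & ~~ ok (x |: [set w i | i : 'I_s])]]| * K <= #|X| ^ s.
Hypothesis N_large : s.+1 * N ^ s < K * N.-1 ^_ s.

Let grid := {ffun 'I_N * 'I_s.+1 -> V}.
Definition grid_row (f : grid) (i : 'I_N) : {set V} := [set f (i, b) | b : 'I_s.+1].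
Let layout (f : grid) := injectiveb f && [forall p, f p \in X].
Let good (f : grid) := [set i | ok (grid_row f i)].

Section Shuffle.
Variables (f : grid) (rho : 'I_s.+1 -> 'I_N) (tau : 'I_s.+1 -> 'I_s.+1).
Hypotheses (f_inj : injective f) (rho_inj : injective rho).

(* The rows [rho a] are replaced by transversals of themselves: the new row
   [rho a] takes from each row [rho b] the entry in column [a + tau b]. *)
Definition shuffle : grid := [ffun p =>
  if [pick a | rho a == p.1] is Some a then f (rho p.2, (a + tau p.2)%R) else f p].

Lemma shuffle_rho a b : shuffle (rho a, b) = f (rho b, (a + tau b)%R).
Proof.
rewrite ffunE /=; case: pickP => [a' /eqP/rho_inj -> //|/(_ a)].
by rewrite eqxx.
Qed.

Lemma shuffle_out i b : (forall a, rho a != i) -> shuffle (i, b) = f (i, b).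
Proof.
by move=> H; rewrite ffunE /=; case: pickP => // a; rewrite (negPf (H a)).
Qed.

Lemma shuffle_inj : injective shuffle.
Proof.
have cases i : (exists a, i = rho a) \/ (forall a, rho a != i).
  have [/existsP[a /eqP <-]|/existsPn H] := boolP [exists a, rho a == i]; last by right.
  by left; exists a.
case=> i b [i' b']; case: (cases i) (cases i') => [[a ->]|H] [[a' ->]|H'].
- rewrite !shuffle_rho => /f_inj E.
  by move: (congr1 fst E) (congr1 snd E) => /= /rho_inj <- /addIr ->.
- by rewrite shuffle_rho shuffle_out // => /f_inj/(congr1 fst)/eqP; rewrite (negPf (H' _)).
- by rewrite shuffle_rho shuffle_out // => /f_inj/(congr1 fst)/esym/eqP;
  rewrite (negPf (H _)).
- by rewrite !shuffle_out // => /f_inj.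
Qed.

End Shuffle.

(* Shuffling the bad row [i0] with [s] random other rows makes all of these rows
   good with positive probability. *)
Lemma partition_improve (f : grid) (i0 : 'I_N) : layout f -> i0 \notin good f ->
  exists2 f', layout f' & #|good f| < #|good f'|.
Proof.
case/andP=> /injectiveP f_inj /forallP fX i0bad.
pose A := [set g : {ffun 'I_s -> 'I_N} * {ffun 'I_s -> 'I_s.+1} |
  (g.1 \in ffun_on (mem [set~ i0])) && injectiveb g.1].
pose w (j : 'I_s.+1) (g : {ffun 'I_s -> 'I_N} * {ffun 'I_s -> 'I_s.+1}) :=
  [ffun a => f (g.1 a, (j + g.2 a)%R)].
pose bad j g := ~~ ok (f (i0, j) |: [set w j g a | a : 'I_s]).
have cA : #|A| = N.-1 ^_ s * s.+1 ^ s.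
  have -> : A = setX [set h :
    {ffun 'I_s -> 'I_N} in ffun_on (mem [set~ i0]) | injectiveb h] setT.
    by apply/setP => -[g1 g2]; rewrite !inE andbT.
  rewrite cardsX card_inj_ffuns_on cardsT card_ffun !card_ord; congr (_ ^_ _ * _).
  by rewrite cardsC1 card_ord.
(* For fixed j the choice g is determined by the sample [w j g], so the bad choices inject into the
   bad samples rooted at f (i0, j). *)
have bad_le j : #|[set g in A | bad j g]| * K <= #|X| ^ s.
  apply: leq_trans (rare (fX (i0, j))); rewrite leq_mul2r; apply/orP; right.
  rewrite -(card_in_imset (f := w j)); last first.
    move=> [g1 g2] [h1 h2] _ _ /ffunP E; congr (_, _); apply/ffunP => a;
    by have := E a; rewrite !ffunE => /f_inj {}E;
       move: (congr1 fst E) (congr1 snd E) => /= E1 /addrI E2; rewrite ?E1 ?E2.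
  apply/subset_leq_card/subsetP => v /imsetP[g]; rewrite !inE.
  case/andP=> /andP[/ffun_onP gi /injectiveP g_inj] gbad ->; rewrite /bad in gbad.
  rewrite gbad andbT; apply/and3P; split.
  - by apply/injectiveP => a b; rewrite !ffunE => /f_inj/(congr1 fst)/g_inj.
  - apply/forallP => a; rewrite ffunE; apply/negP => /eqP/f_inj/(congr1 fst)/eqP.
    by have := gi a; rewrite !inE => /negPf ->.
  - by apply/forallP => a; rewrite ffunE.
have K0 : 0 < K by case: (K) N_large => //; rewrite mul0n.
have [||g] := @bad_choice_card _ 'I_s.+1 A bad (#|X| ^ s %/ K).
- by move=> j; rewrite leq_divRL.
- rewrite card_ord cA -(ltn_pmul2r K0) cardX expnMn.
  apply: leq_ltn_trans (_ : s.+1 * (s.+1 ^ s * N ^ s) < _).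
    by rewrite -mulnA leq_mul2l leq_trunc_div orbT.
  rewrite mulnCA [X in _ < X]mulnAC mulnC ltn_pmul2r ?expn_gt0 //.
  by rewrite [X in _ < X]mulnC.
rewrite inE => /andP[/ffun_onP gi /injectiveP g_inj] gok.
(* The bad row itself takes part with shift 0, so the new row [rho a] consists of the entry f (i0,
   a) and the sample [w a g]: every new row is rooted at a vertex of the bad row. *)
pose rho (a : 'I_s.+1) := if unlift ord0 a is Some b then g.1 b else i0.
pose tau (a : 'I_s.+1) := if unlift ord0 a is Some b then g.2 b else 0%R.
have rho_inj : injective rho.
  move=> a a'; rewrite /rho; case: unliftP => [b ->|->]; case: unliftP => [b' ->|->] //.
  - by move/g_inj ->.
  - by move=> E; have := gi b; rewrite !inE E eqxx.
  - by move=> E; have := gi b'; rewrite !inE -E eqxx.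
exists (shuffle f rho tau).
  apply/andP; split; first by apply/injectiveP; exact: shuffle_inj.
  by apply/forallP => p; rewrite ffunE; case: pickP => [a _|_]; exact: fX.
have rowrho a : grid_row (shuffle f rho tau) (rho a) = f (i0, a) |: [set w a g b | b :
  'I_s].
  apply/setP => y; rewrite !inE; apply/imsetP/orP => [[b _ ->]|[/eqP->|/imsetP[b _ ->]]].
  - rewrite shuffle_rho //; case: (unliftP ord0 b) => [c ->|->]; rewrite /rho /tau.
      by right; rewrite liftK; apply/imsetP; exists c; rewrite ?ffunE.
    by left; rewrite unlift_none addr0.
  - by exists ord0; rewrite // shuffle_rho // /rho /tau unlift_none addr0.
  - by exists (lift ord0 b); rewrite // shuffle_rho // /rho /tau liftK ffunE.
apply/proper_card/properP; split; last first.
  exists i0 => //; have -> : i0 = rho ord0 by rewrite /rho unlift_none.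
  by rewrite inE rowrho; apply/negPn; exact: gok.
apply/subsetP => i; rewrite !inE => oki.
have [/existsP[a /eqP <-]|/existsPn H] := boolP [exists a, rho a == i].
  by rewrite rowrho; apply/negPn; exact: gok.
suff -> : grid_row (shuffle f rho tau) i = grid_row f i by [].
by apply: eq_imset => b; rewrite shuffle_out.
Qed.

(** A layout with the maximal number of good rows has no bad row. In this way a union bound over the
    s+1 rows of one shuffle is enough, whereas one over all N rows would fail. *)
Lemma perfect_partition : exists f : {ffun 'I_N * 'I_s.+1 -> V},
  [/\ injective f, forall p, f p \in X & forall i, ok (grid_row f i)].
Proof.
have [f0 f0P] : exists f, layout f.
  have cg : #|{: 'I_N * 'I_s.+1}| = #|X| by rewrite card_prod !card_ord cardX mulnC.
  pose f := [ffun p : 'I_N * 'I_s.+1 => enum_val (cast_ord cg (enum_rank p))].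
  exists f; apply/andP; split.
    by apply/injectiveP => p q; rewrite !ffunE => /enum_val_inj/cast_ord_inj/enum_rank_inj.
  by apply/forallP => p; rewrite ffunE; exact: enum_valP.
case: (arg_maxnP (fun f => #|good f|) f0P) => f fP fmax.
have [all_good|] := boolP [forall i, i \in good f].
  case/andP: (fP) => /injectiveP f_inj /forallP fX; exists f; split=> // i.
  by have := forallP all_good i; rewrite inE.
rewrite negb_forall => /existsP[i0 i0bad].
have [f' f'P] := partition_improve fP i0bad.
by have /= := fmax f' f'P; rewrite leqNgt => /negbTE ->.
Qed.

End Partition.

(** * A reservoir of pieces chosen with exponential weights *)

Section Reservoir.
Variables (V C : finType) (X : {set V}) (bad : C -> pred {set V}) (s L K b h : nat).
Hypothesis rare : forall c x,
  #|[set w : {ffun 'I_s -> V} | [&& injectiveb w, [forall i, w i != x] &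
       bad c (x |: [set w i | i : 'I_s])]]| * K <= #|V| ^ s.
Hypothesis X_large : s.+1 * L < #|X|.
Hypothesis X_dense : #|V| ^ s <= 2 * (#|X| - s.+1 * L).-1 ^_ s.
Hypothesis b_large : 4 * #|C| <= K * b.+1.
Hypothesis h_small : 4 * h <= K.
Hypothesis C_gt0 : 0 < #|C|.

Let union (l : seq {set V}) : {set V} := \bigcup_(S <- l) S.
(* The exponential weights prevent every single colour from being bad for many of
   the chosen sets, and not only the average colour. *)
Let weight (l : seq {set V}) := \sum_c 2 ^ count (bad c) l.

Let valid (l : seq {set V}) : Prop :=
  [/\ forall S, S \in l -> [/\ S \subset X, #|S| = s.+1 & #|[set c | bad c S]| <= b],
      pairwise (fun S T : {set V} => [disjoint S & T]) l &
      #|union l| = s.+1 * size l].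

Let sub_union (l : seq {set V}) S : S \in l -> S \subset union l.
Proof.
rewrite /union; elim: l => // T l IH; rewrite inE big_cons => /predU1P[->|/IH SU].
  exact: subsetUl.
by apply: subset_trans SU (subsetUr _ _).
Qed.

(** At least half as many samples as there are tuples avoid the union of [l], and by Markov's
    inequality at most a quarter as many are bad for more than b colours. Over the remaining ones,
    [W2], the added weight is on average at most 4/K times the old weight, hence at most 1/h
    times. *)
Lemma reservoir_step (l : seq {set V}) : size l < L -> valid l ->
  exists2 S, valid (S :: l) & h * weight (S :: l) <= h.+1 * weight l.
Proof.
move=> lL [lS ldis lU]; set R := X :\: union l.
have UX : union l \subset X.
  rewrite /union big_seq; elim/big_ind: _ => [|A B AX BX|S /lS[] //].
    exact: sub0set.
  by rewrite subUset AX.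
have cR : #|X| - s.+1 * L <= #|R| by rewrite cardsDS // lU leq_sub2l // leq_mul2l ltnW.
have [x xR] : exists x, x \in R.
  by apply/card_gt0P; apply: leq_trans cR; rewrite subn_gt0.
have V_gt0 : 0 < #|V| by apply/card_gt0P; exists x.
pose set_of (w : {ffun 'I_s -> V}) := x |: [set w i | i : 'I_s].
pose W0 := [set w : {ffun 'I_s -> V} in ffun_on (mem (R :\ x)) | injectiveb w].
have cW0 : #|V| ^ s <= 2 * #|W0|.
  apply: leq_trans X_dense _; rewrite leq_mul2l /W0 card_inj_ffuns_on card_ord.
  have -> : #|R :\ x| = #|R|.-1 by rewrite (cardsD1 x R) xR.
  rewrite -(bin_ffact #|R|.-1) -bin_ffact leq_mul2r leq_bin2l ?orbT //.
  by rewrite -!subn1 leq_sub2r.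
have cbad c : #|[set w in W0 | bad c (set_of w)]| * K <= #|V| ^ s.
  apply: leq_trans (rare c x); rewrite leq_mul2r; apply/orP; right.
  apply/subset_leq_card/subsetP => w; rewrite !inE => /andP[/andP[/ffun_onP wR winj] wbad].
  rewrite winj wbad andbT /=; apply/forallP => i; have := wR i.
  by rewrite !inE => /andP[].
pose nbad w := #|[set c | bad c (set_of w)]|.
pose W1 := [set w in W0 | b < nbad w].
have exch (g : C -> nat) (W : {set {ffun 'I_s -> V}}) : W \subset W0 ->
    K * (\sum_(w in W) \sum_(c | bad c (set_of w)) g c) <= \sum_c g c * #|V| ^ s.
  move=> WW0; rewrite (exchange_big_dep predT) //= big_distrr /=; apply: leq_sum => c _.
  rewrite sum_nat_const mulnC mulnAC mulnC leq_mul2l; apply/orP; right.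
  apply: leq_trans (cbad c); rewrite leq_mul2r; apply/orP; right.
  by apply/subset_leq_card/subsetP => w; rewrite !inE => /andP[/(subsetP WW0)];
    rewrite !inE => -> ->.
have cW1 : 4 * #|W1| <= #|V| ^ s.
  rewrite -(leq_pmul2l C_gt0) mulnA [#|C| * 4]mulnC.
  apply: leq_trans (_ : K * b.+1 * #|W1| <= _); first by rewrite leq_mul2r b_large orbT.
  rewrite -mulnA; apply: leq_trans (_ :
    K * (\sum_(w in W1) \sum_(c | bad c (set_of w)) 1) <= _).
    rewrite leq_mul2l mulnC -sum_nat_const; apply/orP; right; apply: leq_sum => w.
    by rewrite inE sum1_card => /andP[_]; rewrite /nbad cardsE.
  have W10 : W1 \subset W0 by apply/subsetP => w; rewrite inE => /andP[].
  by apply: leq_trans (exch (fun=> 1) W1 W10) _; rewrite sum_nat_const mul1n.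
pose W2 := W0 :\: W1.
have cW2 : #|V| ^ s <= 4 * #|W2|.
  have W10 : W1 \subset W0 by apply/subsetP => w; rewrite inE => /andP[].
  by have := cardsDS W10; rewrite -/W2; move: cW0 cW1; clear; lia.
pose wt w := \sum_(c | bad c (set_of w)) 2 ^ count (bad c) l.
have [w wW2 hw] : exists2 w, w \in W2 & h * wt w <= weight l.
  apply/exists_inP; apply: contraT; rewrite negb_exists_in => /forall_inP small.
  have W20 : W2 \subset W0 by apply: subsetDl.
  have := exch (fun c => 2 ^ count (bad c) l) W2 W20; rewrite -big_distrl /= -/(weight l).
  have : #|W2| * (weight l).+1 <= h * \sum_(w in W2) wt w.
    by rewrite -sum_nat_const big_distrr /=; apply: leq_sum => w /small; rewrite -ltnNge.
  have Vs : 0 < #|V| ^ s by rewrite expn_gt0 V_gt0.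
  have -> : \sum_(w in W2) \sum_(c | bad c (set_of w)) 2 ^ count (bad c) l = \sum_(w in
    W2) wt w by [].
  have K_gt0 : 0 < K by move: b_large C_gt0; clear; case: K => //; rewrite mul0n; lia.
  move: cW2 Vs h_small K_gt0; move: (weight l) #|W2| (#|V| ^ s) (\sum_(w in W2) wt w);
    clear.
  move=> Phi w2 ns S c n0 hK K0 i1 i2.
  have i3 : K * (w2 * Phi.+1) <= h * (Phi * (4 * w2)).
    apply: leq_trans (_ : h * (K * S) <= _);
      first by rewrite [X in _ <= X]mulnCA leq_mul2l i1 orbT.
    by rewrite leq_mul2l (leq_trans i2) ?leq_mul2l ?c ?orbT.
  have i4 : h * (Phi * (4 * w2)) <= K * (w2 * Phi).
    have -> : h * (Phi * (4 * w2)) = (4 * h) * (w2 * Phi) by lia.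
    by rewrite leq_mul2r hK orbT.
  have w20 : 0 < w2 by lia.
  have i5 := leq_trans i3 i4; move: i5; by rewrite !leq_pmul2l // ltnn.
have [wW0 wW1] : w \in W0 /\ w \notin W1 by move: wW2; rewrite inE => /andP[-> ->].
have wR : set_of w \subset R.
  apply/subsetP => y; rewrite !inE => /orP[/eqP ->|/imsetP[i _ ->]].
    by move: xR; rewrite inE.
  move: wW0; rewrite inE => /andP[/ffun_onP/(_ i)]; rewrite !inE.
  by case/and3P=> _ -> ->.
have cS : #|set_of w| = s.+1.
  move: wW0; rewrite inE => /andP[/ffun_onP wi /injectiveP winj].
  rewrite cardsU1 card_imset // card_ord.
  by case: imsetP => // -[i _ xi]; have := wi i; rewrite -xi !inE eqxx.
have RU : [disjoint R & union l] by rewrite -setI_eq0 setIDAC setDIl setDv setI0.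
exists (set_of w).
  split; last first.
  - rewrite /union big_cons -/(union l) cardsU cS lU mulnS.
    have /eqP -> : set_of w :&: union l == set0 by rewrite setI_eq0 (disjointWl wR).
    by rewrite cards0 subn0.
  - rewrite /= ldis andbT; apply/allP => S Sl; apply: disjointWl wR _.
    by apply: disjointWr RU; rewrite /union; exact: sub_union.
  move=> S; rewrite inE => /predU1P[->|/lS //]; split=> //.
    exact: subset_trans wR (subsetDl _ _).
  by move: wW1; rewrite inE wW0 -leqNgt.
have -> : weight (set_of w :: l) = weight l + wt w.
  rewrite /weight /wt [X in _ + X]big_mkcond -big_split /=; apply: eq_bigr => c _.
  by case: ifP => _; rewrite ?addn0 // expnD mul2n addnn.
by rewrite mulnDr mulSn addnC leq_add2r.
Qed.

(** The weight grows from [#|C|] by a factor at most 1 + 1/h in each of the L steps, and a single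
    colour contributes 2 to the power of the number of its bad sets. *)
Lemma reservoir : exists P : nat -> {set V},
  [/\ forall i, i < L -> [/\ P i \subset X, #|P i| = s.+1 & #|[set c | bad c (P i)]| <= b],
      forall i j, i < L -> j < L -> i != j -> [disjoint P i & P j] &
      forall c, 2 ^ #|[set i : 'I_L | bad c (P i)]| * h ^ L <= #|C| * h.+1 ^ L].
Proof.
have [l [sl [lS ldis _] lw]] : exists l, [/\ size l = L, valid l &
    h ^ (size l) * weight l <= #|C| * h.+1 ^ size l].
  have : L <= L by []; elim: {1 3}L => [|m IH] mL.
    exists [::]; split=> //.
      by split=> //; rewrite /union big_nil cards0 muln0.
    by rewrite /weight /= sum_nat_const !expn0 !muln1 mul1n.
  have [l [sl lv lw]] := IH (ltnW mL).
  have [|S Sv Sw] := reservoir_step _ lv; first by rewrite sl.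
  exists (S :: l); split=> //; first by rewrite /= sl.
  rewrite [size _]/= sl.
  rewrite expnSr -mulnA; apply: leq_trans (_ : h ^ m * (h.+1 * weight l) <= _).
    by rewrite leq_mul2l Sw orbT.
  by rewrite mulnCA expnS [#|C| * _]mulnCA leq_mul2l; move: lw; rewrite sl => ->;
    rewrite orbT.
exists (nth set0 l); split.
- by move=> i iL; apply: lS; rewrite mem_nth ?sl.
- move=> i j iL jL; rewrite neq_ltn => /orP[ij|ij].
    by have /(pairwiseP set0) := ldis; apply; rewrite ?inE ?sl.
  by rewrite disjoint_sym; have /(pairwiseP set0) := ldis; apply; rewrite ?inE ?sl.
move=> c; rewrite -sl mulnC; apply: leq_trans lw; rewrite leq_mul2l; apply/orP; right.
rewrite /weight (bigD1 c) //=; apply: leq_trans (leq_addr _ _).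
suff -> : #|[set i : 'I_(size l) | bad c (nth set0 l i)]| = count (bad c) l by [].
rewrite cardsE cardE size_filter -enumT -(count_map (fun i : 'I_(size l) => nth set0 l i)).
congr count; apply: (@eq_from_nth _ set0); first by rewrite size_map size_enum_ord.
move=> i; rewrite size_map size_enum_ord => il.
by rewrite (nth_map (Ordinal il)) ?size_enum_ord // nth_enum_ord.
Qed.
End Reservoir.

(** * Distributing the colours *)

Lemma subset_of_card (T : finType) (A : {set T}) (q : nat) : q <= #|A| ->
  exists2 B : {set T}, B \subset A & #|B| = q.
Proof.
rewrite -bin_gt0 -cards_draws => /card_gt0P[B]; rewrite inE => /andP[BA /eqP cB].
by exists B.
Qed.

Lemma pigeonhole_set (T Theta : finType) (A : {set T}) (ty : T -> Theta) (q : nat) :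
  #|Theta| * q < #|A| ->
  exists B : {set T}, [/\ B \subset A, #|B| = q & {in B &, forall x y, ty x = ty y}].
Proof.
move=> lt.
have [th hth] : exists th, q <= #|[set x in A | ty x == th]|.
  apply/existsP; apply: contraT; rewrite negb_exists => /forallP small.
  move: lt; rewrite ltnNge -sum_nat_const -sum1_card (partition_big ty predT) //=.
  case/negP; apply: leq_sum => th _; rewrite sum1_card.
  have := small th; rewrite -ltnNge => /ltnW; apply: leq_trans.
  by apply: eq_leq; rewrite cardsE.
have [B BA cB] := subset_of_card hth.
exists B; split=> //; first by apply: subset_trans BA _; apply/subsetP => x;
  rewrite inE => /andP[].
move=> x y /(subsetP BA); rewrite inE => /andP[_ /eqP ->].
by move=> /(subsetP BA); rewrite inE => /andP[_ /eqP ->].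
Qed.

Section ColourAssignment.
Variables (C Theta : finType) (N L q b : nat) (CC : {set C}).
Variables (good : C -> 'I_N -> bool) (ty : C -> 'I_N -> Theta).
Hypothesis q_gt0 : 0 < q.
Hypothesis cardCC : #|CC| = q * N.
Hypothesis few_bad : forall i, #|[set c | ~~ good c i]| <= b.
Hypothesis often_good : forall c, 4 * q * #|[set i : 'I_N | (i < L) && ~~ good c i]| <= L.

Let M := #|Theta|.
Hypothesis N_large : L + b + M * q <= N.
Hypothesis L_large : 4 * (q * (b + M * q) + b + M * q) < 3 * L.

Definition mono (i : 'I_N) (D : {set C}) : Prop :=
  {in D, forall c, good c i} /\ {in D &, forall c c', ty c i = ty c' i}.

(** The second case describes a piece after one exchange. The new colour [c'] has to be good there,
    but its type is arbitrary. *)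
Definition nearly_mono (i : 'I_N) (D : {set C}) : Prop :=
  mono i D \/ exists D0 c c', [/\ mono i D0 /\ #|D0| = q, c \in D0, c' \notin D0,
    good c' i & D = c' |: (D0 :\ c)].

Let owned (own : C -> option 'I_N) (i : 'I_N) := [set c in CC | own c == Some i].
Let free (own : C -> option 'I_N) := [set c in CC | own c == None].

(* The pieces below [j] have been served; the pieces in [Z] are those of the
   reservoir which have already given a colour away. *)
Let valid (j : nat) (own : C -> option 'I_N) (Z : {set 'I_N}) : Prop :=
  [/\ forall c i, own c = Some i -> i < j,
      forall i : 'I_N, i < j -> #|owned own i| = q /\ nearly_mono i (owned own i) &
      forall i : 'I_N, i < L -> i < j -> i \notin Z -> mono i (owned own i)].

Let free_card j own Z : j <= N -> valid j own Z -> #|free own| = q * (N - j).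
Proof.
move=> jN [oj oq _].
have E : \sum_(i < N) #|owned own i| = q * j.
  transitivity (\sum_(i < N) if i < j then q else 0).
    apply: eq_bigr => i _; case: ifP => ij; first by case: (oq i ij).
    apply: eq_card0 => c; rewrite inE; apply/negP => /andP[_ /eqP/oj].
    by rewrite ij.
  by rewrite -big_mkcond /= sum_nat_const -sum1_card (big_ord_narrow jN) sum1_card
    card_ord mulnC.
have : #|CC| = #|free own| + \sum_(i < N) #|owned own i|.
  have split1 c : 1 = (own c == None) + \sum_(i < N) (own c == Some i).
    case: (own c) => [i|] /=; last by rewrite big1.
    rewrite (bigD1 i) //= eqxx big1 // => i' ii'.
    by rewrite (inj_eq Some_inj) eq_sym (negPf ii').
  rewrite -sum1_card (eq_bigr _ (fun c _ => split1 c)) big_split /= exchange_big /=.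
  have cnt (P : pred C) : \sum_(c in CC) (P c : nat) = #|[set c in CC | P c]|.
    rewrite -sum1_card [RHS](eq_bigl (fun c => (c \in CC) && P c)) => [|c];
      last by rewrite inE.
    by rewrite big_mkcondr /=; apply: eq_bigr => c _; case: (P c).
  by congr (_ + _); [|apply: eq_bigr => i _]; exact: cnt.
rewrite cardCC E mulnBr => ->; by rewrite addnK.
Qed.

(** At most b of the free colours are bad for piece j, so more than [M * q] are good for it, and q
    of these have the same type. *)
Let step_fresh j own : (j < N)%N -> b + M * q < q * (N - j) -> valid j own set0 ->
  exists own', valid j.+1 own' set0.
Proof.
move=> jN jsmall v; have cf := free_card (ltnW jN) v; case: v => oj oq om.
pose jo := Ordinal jN.
have [B [BA cB Bty]] : exists B :
  {set C}, [/\ B \subset [set c in free own | good c jo], #|B| = q &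
   {in B &, forall x y, ty x jo = ty y jo}].
  apply: pigeonhole_set; rewrite -/M.
  have : #|free own| <= #|[set c in free own | good c jo]| + #|[set c | ~~ good c jo]|.
    rewrite -cardsUI; apply: leq_trans (leq_addr _ _);
      apply/subset_leq_card/subsetP => c cf'.
    by move: cf'; rewrite !inE => ->; case: good.
  by have := few_bad jo; rewrite cf; move: jsmall; clear; lia.
have Bfree c : c \in B -> [/\ c \in CC, own c = None & good c jo].
  by move/(subsetP BA); rewrite !inE => /andP[/andP[-> /eqP ->] ->].
exists (fun c => if c \in B then Some jo else own c).
have ownedj : owned (fun c => if c \in B then Some jo else own c) jo = B.
  apply/setP => c; rewrite inE; have [cB'|cB'] := boolP (c \in B).
    by case: (Bfree c cB') => -> _ _; rewrite eqxx.
  apply/negP => /andP[_ /eqP/oj]; by rewrite ltnn.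
have ownedi i : i != jo -> owned (fun c =>
  if c \in B then Some jo else own c) i = owned own i.
  move=> ij; apply/setP => c; rewrite !inE; have [cB'|//] := boolP (c \in B).
  case: (Bfree c cB') => _ -> _; rewrite andbC [RHS]andbC /=.
  by rewrite eq_sym; apply/negP => /andP[/eqP[]/eqP]; rewrite (negPf ij).
have monoj : mono jo B by split=> // c /Bfree[].
have cases (i : 'I_N) : i < j.+1 -> i = jo \/ (i != jo) /\ i < j.
  rewrite ltnS leq_eqVlt => /predU1P[ij|ij]; [left; exact: val_inj|right].
  by rewrite ij -val_eqE /= neq_ltn ij.
split.
- move=> c i; case: ifP => _ [ci]; last by rewrite ltnS ltnW // (oj c).
  by rewrite -ci /=.
- move=> i /cases[->|[ij1 ij]]; first by rewrite ownedj; split=> //; left.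
  by rewrite ownedi //; apply: oq.
move=> i iL /cases[->|[ij1 ij]] iZ; first by rewrite ownedj.
by rewrite ownedi //; apply: om.
Qed.

(** Piece j takes one colour [rep i] from each of q reservoir pieces i, all of the same type at j,
    and the q free colours in [B0] replace them through the bijection [sigma]. Recording these
    pieces in [Z] ensures that no piece is exchanged twice, as [nearly_mono] requires. *)
Let step_swap j own (Z : {set 'I_N}) : (j < N)%N -> L <= j -> valid j own Z ->
  4 * (#|Z| + b + M * q) < 3 * L ->
  exists own', exists Z' : {set 'I_N}, #|Z'| <= #|Z| + q /\ valid j.+1 own' Z'.
Proof.
move=> jN Lj v Zsmall; have cf := free_card (ltnW jN) v; case: v => oj oq om.
pose jo := Ordinal jN.
have [B0 B0free cB0] : exists2 B0 : {set C}, B0 \subset free own & #|B0| = q.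
  by apply: subset_of_card; rewrite cf leq_pmulr // subn_gt0.
have B0P c : c \in B0 -> c \in CC /\ own c = None.
  by move/(subsetP B0free); rewrite inE => /andP[-> /eqP].
have [c0 _] : exists c, c \in B0 by apply/card_gt0P; rewrite cB0.
have ownedP i c : c \in owned own i -> c \in CC /\ own c = Some i.
  by rewrite inE => /andP[-> /eqP].
pose rep i := odflt c0 [pick c in owned own i | good c jo].
pose I := [set i : 'I_N | [&& i < L, i \notin Z, [forall c in B0, good c i] &
                              [exists c in owned own i, good c jo]]].
have repP i : i \in I -> [/\ rep i \in owned own i & good (rep i) jo].
  rewrite inE => /and4P[_ _ _ /exists_inP[c co cg]]; rewrite /rep.
  by case: pickP => [c' /andP[]|/(_ c)] //; rewrite co cg.
(* Of the L reservoir pieces, [#|Z|] at most have been used before, and at most q L/(4q) = L/4 are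
   bad for some colour in [B0]. At most b own only colours that are bad for j, because different
   pieces own different colours ([cT]). By hypothesis more than [M * q] are left. *)
have cI : M * q < #|I|.
  pose T := [set i : 'I_N | (i < L) && [forall c in owned own i, ~~ good c jo]].
  have cT : #|T| <= b.
    pose m i := odflt c0 [pick c in owned own i].
    have mP i : i \in T -> m i \in owned own i.
      rewrite inE => /andP[iL _]; rewrite /m; case: pickP => [c //|H].
      have [] := oq i (leq_trans iL Lj).
      by rewrite (eq_card0 H) => q0; move: q_gt0; rewrite -q0.
    rewrite -(card_in_imset (f := m)); last first.
      move=> i i' /mP/ownedP[_ o1] /mP/ownedP[_ o2] E.
      by move: o1; rewrite E o2 => -[].
    apply: leq_trans (few_bad jo); apply/subset_leq_card/subsetP => c /imsetP[i iT ->].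
    by have := mP i iT; move: iT;
      rewrite !inE => /andP[_ /forall_inP H] /[dup] mo /andP[_ _]; apply: H; rewrite inE.
  have cB : 4 * \sum_(w in B0) #|[set i : 'I_N | (i < L) && ~~ good w i]| <= L.
    rewrite -(leq_pmul2l q_gt0) mulnCA mulnA big_distrr /= -{2}cB0 -sum_nat_const.
    by apply: leq_sum => w _; exact: often_good.
  have LN : L <= N by apply: leq_trans N_large; rewrite -addnA leq_addr.
  have cL : #|[set i : 'I_N | i < L]| = L.
    by rewrite cardsE -sum1_card (big_ord_narrow LN) sum1_card card_ord.
  have : L <= #|Z| + \sum_(w in B0) #|[set i :
    'I_N | (i < L) && ~~ good w i]| + #|T| + #|I|.
    rewrite -{1}cL.
    pose BU := \bigcup_(w in B0) [set i : 'I_N | (i < L) && ~~ good w i].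
    apply: leq_trans (_ : #|Z :|: BU :|: T :|: I| <= _).
      apply/subset_leq_card/subsetP => i; rewrite [i \in finset _]inE => iL;
        rewrite 3!in_setU.
      have [//|iZ] := boolP (i \in Z).
      have [//|iB] := boolP (i \in BU).
      rewrite [i \in T]inE iL; have [//|] := boolP [forall c in owned own i, ~~ good c jo].
      rewrite negb_forall_in => /exists_inP[c co]; rewrite negbK => cg.
      rewrite inE iL iZ /=; apply/andP; split; last by apply/exists_inP; exists c.
      apply/forall_inP => w wB; apply: contraNT iB => wg.
      by apply/bigcupP; exists w; rewrite // inE iL.
    apply: leq_trans (leq_card_setU _ _) _; rewrite leq_add2r.
    apply: leq_trans (leq_card_setU _ _) _; rewrite leq_add2r.
    apply: leq_trans (leq_card_setU _ _) _; rewrite leq_add2l.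
    exact: card_bigcup_le.
  move: cT cB Zsmall; move: #|T| (\sum_(w in B0) _) #|I| #|Z| (M * q); clear; lia.
have [I' [I'I cI' I'ty]] := pigeonhole_set (fun i => ty (rep i) jo) cI.
have I'P i : i \in I' -> [/\ i < L, i \notin Z, {in B0, forall c, good c i},
    rep i \in owned own i & good (rep i) jo].
  move=> /(subsetP I'I) iI; have [r1 r2] := repP i iI; move: iI; rewrite inE.
  by case/and4P=> iL iZ /forall_inP iB _; split.
have [i0 i0I'] : exists i, i \in I' by apply/card_gt0P; rewrite cI'.
pose sigma c := nth i0 (enum I') (index c (enum B0)).
have sigmaI' c : c \in B0 -> sigma c \in I'.
  by move=> cB; rewrite -mem_enum mem_nth // -cardE cI' -cB0 cardE index_mem mem_enum.
have sigma_inj : {in B0 &, injective sigma}.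
  move=> c c' cB cB' /eqP; rewrite nth_uniq ?enum_uniq -?cardE ?cI' -?cB0 ?cardE
    ?index_mem ?mem_enum //.
  by move=> /eqP; apply: (index_inj c0); rewrite mem_enum.
have sigma_img : sigma @: B0 = I'.
  apply/eqP; rewrite eqEcard card_in_imset // cB0 cI' leqnn andbT.
  by apply/subsetP => i /imsetP[c cB ->]; exact: sigmaI'.
pose Bj := rep @: I'.
have rep_own i : i \in I' -> own (rep i) = Some i by case/I'P=> _ _ _ /ownedP[].
have rep_inj : {in I' &, injective rep}.
  by move=> i i' iI iI' E; have := rep_own i iI; rewrite E rep_own // => -[].
pose own' c := if c \in Bj then Some jo else if c \in B0 then Some (sigma c) else own c.
have BjP c : c \in Bj -> exists2 i, i \in I' & c = rep i by move/imsetP.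
have ownedj : owned own' jo = Bj.
  apply/setP => c; rewrite inE /own';
    have [/BjP[i /I'P[_ _ _ /ownedP[iCC _] _] ->]|cj] := boolP (c \in Bj).
    by rewrite iCC eqxx.
  case: ifP => [cB|_].
    apply/negP => /andP[_ /eqP[sj]]; have [sL _ _ _ _] := I'P _ (sigmaI' c cB).
    by move: sL; rewrite sj /= ltnNge Lj.
  by apply/negP => /andP[_ /eqP/oj]; rewrite ltnn.
have ownedi i : i != jo -> i \notin I' -> owned own' i = owned own i.
  move=> ij iI; apply/setP => c; rewrite !inE /own'.
  have [/BjP[i' i'I ->]|cj] := boolP (c \in Bj).
    rewrite rep_own // !(inj_eq Some_inj) [jo == i]eq_sym (negPf ij).
    by case: eqP => [ii|]; [rewrite -ii i'I in iI|rewrite !andbF].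
  case: ifP => [cB|_ //]; have [_ ->] := B0P c cB.
  rewrite (inj_eq Some_inj) [_ == _ :> option _]/= andbF; case: eqP => [si|];
    last by rewrite andbF.
  by rewrite -si sigmaI' in iI.
have ownedI c : c \in B0 -> owned own' (sigma c) = c |: (owned own (sigma c) :\ rep
  (sigma c)).
  move=> cB; have sI := sigmaI' c cB; have [sL _ _ _ _] := I'P _ sI.
  have sj : jo != sigma c by rewrite -val_eqE /= neq_ltn (leq_trans sL Lj) orbT.
  apply/setP => c'; rewrite !inE /own'.
  have [/BjP[i' i'I ->]|cj] := boolP (c' \in Bj).
    rewrite rep_own // !(inj_eq Some_inj) (negPf sj) andbF.
    have [E|_] := eqVneq (rep i') c; first by have [_] := B0P c cB; rewrite -E rep_own.
    by have [->|_] := eqVneq i' (sigma c); rewrite ?eqxx ?andbF.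
  have c'rep : c' != rep (sigma c) by apply: contra cj => /eqP ->; apply: imset_f.
  case: ifP => [cB'|cB']; last first.
    by rewrite c'rep /=; have [E|//] := eqVneq c' c; rewrite E cB in cB'.
  have [-> ->] := B0P c' cB'; rewrite (inj_eq Some_inj) /= !andbF orbF.
  by apply/eqP/eqP => [/sigma_inj->|->].
have cases (i : 'I_N) : i < j.+1 ->
    [\/ i = jo, exists2 c, c \in B0 & i = sigma c | [/\ i != jo, i \notin I' & i < j]].
  rewrite ltnS leq_eqVlt => /predU1P[ij|ij]; first by apply: Or31; exact: val_inj.
  have [iI|iI] := boolP (i \in I').
    by move: iI; rewrite -sigma_img => /imsetP[c cB ->]; apply: Or32; exists c.
  by apply: Or33; split=> //; rewrite -val_eqE /= neq_ltn ij.
have monoj : mono jo Bj.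
  split=> [c /BjP[i /I'P[] //]|c c' /BjP[i iI ->] /BjP[i' iI' ->]];
    first by move=> _ _ _ _ rg ->.
  exact: I'ty.
exists own', (Z :|: I'); split.
  by rewrite -cI'; exact: leq_card_setU.
split.
- move=> c i; rewrite /own'; case: ifP => [_ [<-]|_] //=; case: ifP => [cB [<-]|_].
    by have [sL _ _ _ _] := I'P _ (sigmaI' c cB); rewrite ltnS (leq_trans (ltnW sL)).
  by move/oj/ltnW.
- move=> i /cases[->|[c cB ->]|[ij iI' i_lt]]; last by rewrite ownedi //; apply: oq.
    by rewrite ownedj /Bj card_in_imset // cI'; split=> //; left.
  have [sL sZ sB so sg] := I'P _ (sigmaI' c cB).
  have slt := leq_trans sL Lj; have [qs _] := oq _ slt.
  have cn : c \notin owned own (sigma c).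
    by rewrite inE; have [-> ->] := B0P c cB.
  rewrite ownedI //; split.
    have cn' : c \notin owned own (sigma c) :\ rep (sigma c) by rewrite inE (negPf cn)
      andbF.
    by rewrite cardsU1 cn' -qs [in RHS](cardsD1 (rep (sigma c))) so.
  right; exists (owned own (sigma c)), (rep (sigma c)), c; split=> //.
    by split=> //; apply: om.
  exact: sB.
move=> i iL /cases[->|[c cB ->]|[ij iI' i_lt]]; rewrite inE negb_or => /andP[iZ iI].
- by rewrite ownedj.
- by rewrite sigmaI' in iI.
by rewrite ownedi //; apply: om.
Qed.

Lemma colour_assignment : exists D : 'I_N -> {set C},
  [/\ forall i, D i \subset CC /\ #|D i| = q, forall i, nearly_mono i (D i),
      forall i i', i != i' -> [disjoint D i & D i'] & \bigcup_i D i = CC].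
Proof.
(* While more than [J] pieces are unserved, more than [J] colours are free and a fresh choice is
   possible. Each of the last [J] pieces adds at most q pieces to [Z], which is what [L_large]
   allows for. *)
pose J := b + M * q.
have phase1 j : j <= N - J -> exists own, valid j own set0.
  elim: j => [|j IH] jN.
    by exists (fun=> None); split=> // i; rewrite ltn0.
  have [|own v] := IH; first exact: ltnW.
  apply: (step_fresh _ _ v); first by move: jN; clear; lia.
  rewrite -/J; apply: leq_trans (_ : N - j <= _); first by move: jN; clear; lia.
  by rewrite leq_pmull.
have JN : L + J <= N by rewrite /J addnA.
have phase2 m : m <= J -> exists own, exists Z :
  {set 'I_N}, #|Z| <= q * m /\ valid (N - J + m) own Z.
  elim: m => [|m IH] mJ.
    by have [own v] := phase1 _ (leqnn _); exists own, set0; rewrite cards0 addn0.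
  have [|own [Z [cZ v]]] := IH; first exact: ltnW.
  have [|||own' [Z' [cZ' v']]] := step_swap _ _ v.
  - by move: mJ JN; clear; lia.
  - by move: JN; clear; lia.
  - apply: leq_ltn_trans L_large; rewrite leq_mul2l /= -!addnA leq_add2r.
    by apply: leq_trans cZ _; rewrite leq_mul2l ltnW ?orbT.
  by exists own', Z'; rewrite addnS mulnS addnC (leq_trans cZ') // leq_add2r.
have [own [Z [_ v]]] := phase2 J (leqnn _).
have NJ : N - J + J = N by apply: subnK; apply: leq_trans JN; exact: leq_addl.
rewrite NJ in v; have cf := free_card (leqnn N) v; case: v => _ oq _.
exists (owned own); split.
- move=> i; split; first by apply/subsetP => c; rewrite inE => /andP[].
  by case: (oq i (ltn_ord i)).
- by move=> i; case: (oq i (ltn_ord i)).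
- move=> i i' ii'; rewrite -setI_eq0; apply/eqP/setP => c; rewrite !inE.
  apply/negP => /andP[/andP[_ /eqP ->] /andP[_ /eqP[ii]]].
  by rewrite ii eqxx in ii'.
apply/setP => c; apply/bigcupP/idP => [[i _]|cCC]; first by rewrite inE => /andP[].
case oc: (own c) => [i|]; first by exists i; rewrite // inE cCC oc eqxx.
have : c \in free own by rewrite inE cCC oc eqxx.
by rewrite (@cards0_eq _ (free own)) ?inE // cf subnn muln0.
Qed.

End ColourAssignment.

(** * Assembling the tiling *)

(** Every factor of the falling factorial is at least n-a with a = n+s-y, and by Bernoulli's
    inequality (n-a)^s is at least n^s (1 - sa/n). *)
Lemma expn_le_ffact (n y s : nat) : 2 * s * (n + s - y) <= n -> n ^ s <= 2 * y ^_ s.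
Proof.
move=> H; have [->|n0] := posnP n.
  by case: s H => [|s] _; rewrite ?expn0 ?ffactn0 // exp0n.
have low : (n - (n + s - y)) ^ s <= y ^_ s.
  have [ys|sy] := leqP y s.
    have -> : n - (n + s - y) = 0 by lia.
    case: s H ys => [|s] _ _; rewrite ?expn0 ?ffactn0 // exp0n //.
  have := @expn_sub_le_ffact y s 0 s; rewrite !subn0 => /(_ (leqnn _)); apply: leq_trans.
  have : n - (n + s - y) <= y - s by lia.
  by case: (s) => // s' le; rewrite leq_exp2r.
have := expn_sub_ge n (n + s - y) s; move: low H n0.
move: (n + s - y) => a; move: ((n - a) ^ s) (y ^_ s) (n ^ s) => p f X low H n0 H2.
rewrite -(leq_pmul2r n0).
have : 2 * s * a * X <= n * X by rewrite leq_mul2r H orbT.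
have : p * n <= f * n by rewrite leq_mul2r low orbT.
move: H2; clear; nia.
Qed.

Lemma ffact_le_expn (n m : nat) : n ^_ m <= n ^ m.
Proof. by elim: m => // m IH; rewrite ffactnSr expnSr leq_mul // leq_subr. Qed.

Section Types.
Variables (V C : finType) (G : C -> {set {set V}}).

(** Transporting the trace to the fixed vertex set ['I_m] bounds the number of possible traces
    independently of V and of the piece. *)
Definition trace (m : nat) (z : 'I_m -> V) (c : C) : {set {set 'I_m}} :=
  [set A : {set 'I_m} | z @: A \in G c].

Lemma trace_edge (m : nat) (z : 'I_m -> V) (c c' : C) (e : {set V}) :
  trace z c = trace z c' -> e \subset z @: setT -> e \in G c -> e \in G c'.
Proof.
move=> E eS ec; have ze : e = z @: [set i | z i \in e].
  apply/setP => x; apply/idP/imsetP => [xe|[i]]; last by rewrite inE => ? ->.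
  have /imsetP[i _ xi] := subsetP eS x xe.
  by exists i; rewrite ?inE -?xi.
have : [set i | z i \in e] \in trace z c by rewrite inE -ze.
by rewrite E inE -ze.
Qed.

End Types.

Lemma enum_onto (V : finType) (S : {set V}) (m : nat) : #|S| = m ->
  exists z : {ffun 'I_m -> V}, z @: setT == S.
Proof.
move=> <-; exists [ffun i => enum_val i]; apply/eqP/setP => x.
apply/imsetP/idP => [[i _ ->]|xS]; first by rewrite ffunE enum_valP.
by exists (enum_rank_in xS x); rewrite // ffunE enum_rankK_in.
Qed.

Lemma bigcup_tiled k (VF V C : finType) (F : kgraph k VF) (G : C -> {set {set V}})
    (I : finType) (pc : I -> {set V}) (D : I -> {set C}) :
  (forall i j, i != j -> [disjoint pc i & pc j]) ->
  (forall i j, i != j -> [disjoint D i & D j]) ->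
  (forall i, rainbow_tiled F G (pc i) (D i)) ->
  rainbow_tiled F G (\bigcup_i pc i) (\bigcup_i D i).
Proof.
move=> dpc dD tiled.
have dis (T : finType) (A : I -> {set T}) i (l : seq I) :
    (forall i j, i != j -> [disjoint A i & A j]) -> i \notin l ->
    [disjoint A i & \bigcup_(j <- l) A j].
  move=> dA; elim: l => [|j l IH]; first by rewrite big_nil -setI_eq0 setI0.
  rewrite inE negb_or big_cons -setI_eq0 setIUr setU_eq0 => /andP[ij il].
  by rewrite !setI_eq0 dA ?IH.
elim: (index_enum I) (index_enum_uniq I) => [|i l IH] /=.
  by rewrite !big_nil; constructor.
case/andP=> il ul; rewrite !big_cons; apply: rainbow_tiledU => //.
- exact: dis.
- exact: dis.
exact: IH.
Qed.

Section Assembly.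
Variables (k : nat) (VF : finType) (F : kgraph k VF) (V C : finType) (G :
  C -> {set {set V}}).
Variables (dense : {set {set V}} -> {set V} -> bool).
Variables (t s N r m K : nat).
(* Pieces have [s.+1] vertices and [q] colours, and [L] of them form the reservoir;
   a set of vertices is acceptable if at most [b] colours are sparse on it. *)
Let q := nedges F * t.
Let Kb := 64 * s.+1 * q ^ 2.
Let b := #|C| %/ Kb.
Let L := 16 * q * m.
Let M := #|{: {set {set 'I_s.+1}}}|.

Hypothesis F_nonempty : 0 < nedges F.
Hypothesis t_gt0 : 0 < t.
Hypothesis size_piece : s.+1 = #|VF| * t.
Hypothesis r_lt : r < t.
Hypothesis card_V : #|V| = s.+1 * N + #|VF| * r.
Hypothesis card_C : #|C| = q * N + nedges F * r.
Hypothesis mono_tiled : forall c (S : {set V}), #|S| = s.+1 -> dense (G c) S ->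
  forall r, r <= t -> exists2 S' : {set V}, S' \subset S /\ #|S'| = #|VF| * r &
    forall D : {set C}, #|D| = nedges F * r ->
      (forall c', c' \in D -> forall e : {set V}, e \subset S -> e \in G c -> e \in G c') ->
      rainbow_tiled F G S' D.
Hypothesis swap_tiled : forall c0 (S : {set V}) c (D :
  {set C}), #|S| = s.+1 -> dense (G c0) S ->
  dense (G c) S -> c \notin D -> #|D|.+1 = q ->
  (forall c', c' \in D -> forall e : {set V}, e \subset S -> e \in G c0 -> e \in G c') ->
  rainbow_tiled F G S (c |: D).
Hypothesis rare : forall c x,
  #|[set w : {ffun 'I_s -> V} | [&& injectiveb w, [forall i, w i != x] &
       ~~ dense (G c) (x |: [set w i | i : 'I_s])]]| * K <= #|V| ^ s.
Hypothesis K_large : 2 * Kb * (2 * s.+1).+1 <= K.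
Hypothesis m_def : m = N %/ (64 * s.+1 * q).
Hypothesis m_large : Kb + M * q + s.+1 + 2 <= m.

Let bad c S := ~~ dense (G c) S.
Let q_gt0 : 0 < q. Proof. by rewrite muln_gt0 F_nonempty. Qed.
Let Kb_gt0 : 0 < Kb. Proof. by rewrite /Kb muln_gt0 /= expn_gt0 q_gt0. Qed.
Let d_gt0 : 0 < 64 * s.+1 * q. Proof. by rewrite muln_gt0 q_gt0. Qed.
Let N_lt : N < 64 * s.+1 * q * m.+1.
Proof. by rewrite m_def mulnC ltn_ceil // d_gt0. Qed.
Let N_ge : 64 * s.+1 * q * m <= N.
Proof. by rewrite m_def mulnC leq_trunc_div. Qed.
Let C_lt : #|C| < q * N.+1.
Proof. by rewrite card_C mulnS addnC ltn_add2r ltn_pmul2l. Qed.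
(** Here the value of [Kb] is decisive: |C| < q(N+1) <= 64 (s+1) q^2 (m+1) = Kb (m+1). *)
Let b_le : b <= m.
Proof.
rewrite -ltnS /b ltn_divLR //; apply: leq_trans C_lt _.
apply: leq_trans (_ : q * (64 * s.+1 * q * m.+1) <= _);
  first by rewrite leq_mul2l N_lt orbT.
rewrite /Kb; apply: eq_leq; ring.
Qed.
Let C_lt_b : #|C| < Kb * b.+1.
Proof. by rewrite mulnC ltn_ceil. Qed.
Let card_V_lt : #|V| < s.+1 * N.+1.
Proof. by rewrite card_V mulnS addnC ltn_add2r size_piece ltn_pmul2l //;
  move: size_piece; case: #|VF|. Qed.
Let C_gt0 : 0 < #|C|.
Proof.
rewrite card_C addn_gt0 muln_gt0 q_gt0 /=; apply/orP; left.
apply: leq_trans N_ge; rewrite muln_gt0 d_gt0; by move: m_large; clear; lia.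
Qed.

Lemma mono_set_tiled (z : 'I_s.+1 -> V) (S : {set V}) (D : {set C}) :
  #|S| = s.+1 -> z @: setT = S -> #|D| = q ->
  {in D, forall c, dense (G c) S} -> {in D &, forall c c', trace G z c = trace G z c'} ->
  forall r, r <= t -> exists2 S' : {set V}, S' \subset S /\ #|S'| = #|VF| * r &
    forall D' : {set C}, #|D'| = nedges F * r -> D' \subset D -> rainbow_tiled F G S' D'.
Proof.
move=> cS zS cD dD tD r' r't.
have [c cD'] : exists c, c \in D by apply/card_gt0P; rewrite cD.
have [S' S'P HS'] := mono_tiled cS (dD c cD') r't.
exists S' => // D' cD'' D'D; apply: HS' => // c' c'D' e eS.
by apply: (trace_edge (z := z)); rewrite ?zS //; apply: tD => //; apply: (subsetP D'D).
Qed.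

Lemma nearly_mono_tiled (z : 'I_s.+1 -> V) (S : {set V}) (N' : nat) (i : 'I_N') (D :
  {set C}) :
  #|S| = s.+1 -> z @: setT = S -> #|D| = q ->
  nearly_mono q (fun c _ => dense (G c) S) (fun c _ => trace G z c) i D ->
  rainbow_tiled F G S D.
Proof.
move=> cS zS cD [[dD tD]|[D0 [c [c' [[[dD tD] cD0] cD0' c'D0 c'd DE]]]]].
  have [S' [S'S cS'] HS'] := mono_set_tiled cS zS cD dD tD (leqnn t).
  have -> : S = S' by apply/esym/eqP; rewrite eqEcard S'S cS' cS size_piece leqnn.
  by apply: HS'.
rewrite DE; apply: (swap_tiled (c0 := c)) => //.
- exact: dD.
- by rewrite !inE negb_and negbK c'D0 orbT.
- by rewrite -cD0 [RHS](cardsD1 c) cD0'.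
move=> c2; rewrite !inE => /andP[_ c2D] e eS.
by apply: (trace_edge (z := z)); rewrite ?zS //; apply: tD.
Qed.

Let m_gt : M * q + s.+1 + 2 <= m.
Proof. by move: m_large; set x := M * q; clear; lia. Qed.
Let N_ge_m : 64 * s.+1 * m <= N.
Proof. by apply: leq_trans N_ge; rewrite leq_mul2r leq_pmulr ?orbT. Qed.
Let V_ge : 64 * s.+1 * s.+1 <= #|V|.
Proof.
rewrite card_V; apply: leq_trans (leq_addr _ _); rewrite mulnC leq_mul2l /=.
apply: leq_trans N_ge_m; rewrite -[X in X <= _]muln1 leq_mul2l /=.
by move: m_gt; clear; lia.
Qed.
Let C_ge : 64 * m <= #|C|.
Proof.
rewrite card_C; apply: leq_trans (leq_addr _ _); apply: leq_trans (leq_pmull _ q_gt0).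
by apply: leq_trans N_ge_m; rewrite leq_mul2r leq_pmulr ?orbT.
Qed.
Let K_ge : 4 * #|C| <= K * b.+1.
Proof.
apply: leq_trans (_ : 4 * (Kb * b.+1) <= _); first by rewrite leq_mul2l ltnW.
rewrite mulnA leq_mul2r; apply/orP; right; apply: leq_trans K_large.
by rewrite [2 * _]mulnC -mulnA mulnC leq_mul2l; apply/orP; right; clear; lia.
Qed.
Let few_bad_good S : #|[set c | bad c S]| <= b -> M * q < #|[set c | dense (G c) S]|.
Proof.
move=> Sb; have : #|C| = #|[set c | bad c S]| + #|[set c | dense (G c) S]|.
  rewrite -[LHS](cardsC [set c | bad c S]); congr (_ + _); apply: eq_card => c.
  by rewrite !inE /bad negbK.
by move: Sb b_le C_ge m_gt; clear; lia.
Qed.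

(** Removing these vertices and colours leaves exactly N full pieces of vertices and of colours. *)
Lemma first_piece : exists (S : {set V}) (D : {set C}),
  [/\ #|S| = #|VF| * r, #|D| = nedges F * r & rainbow_tiled F G S D].
Proof.
(* A reservoir of one set is simply a set on which at most b colours are sparse; with h = 0 the
   weight condition is void. *)
have [||||||P [P1 _ _]] := @reservoir V C setT bad s 1 K b 0.
- exact: rare.
- rewrite cardsT muln1; apply: leq_trans V_ge; rewrite -mulnA; clear; nia.
- rewrite cardsT muln1; apply: expn_le_ffact; move: V_ge; clear.
  move: #|V| => n hn; have : n + s - (n - s.+1).-1 <= 2 * s.+1 by lia.
  move: (n + s - (n - s.+1).-1) => a ha; nia.
- exact: K_ge.
- by [].
- exact: C_gt0.
have [_ cS Sbad] := P1 0 isT; set S := P 0 in cS Sbad.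
have [z /eqP zS] := enum_onto cS.
have [B [BA cB Bty]] := pigeonhole_set (trace G z) (few_bad_good Sbad).
have Bd : {in B, forall c, dense (G c) S} by move=> c /(subsetP BA); rewrite inE.
have [S' [S'S cS'] HS'] := mono_set_tiled cS zS cB Bd Bty (ltnW r_lt).
have [|D DB cD] := @subset_of_card C B (nedges F * r).
  by rewrite cB leq_mul2l (ltnW r_lt) orbT.
by exists S', D; split=> //; apply: HS'.
Qed.

Let h := 32 * q.
Let L_le : 4 * (s.+1 * L) <= N.
Proof. by apply: leq_trans N_ge; rewrite /L; move: q; clear; nia. Qed.
Let L_gt0 : 0 < L.
Proof.
have m0 : 0 < m by move: m_gt; clear; lia.
by move: q_gt0 m0; rewrite /L; move: q m; clear; nia.
Qed.

Let pow_h : h.+1 ^ L <= 2 ^ m * h ^ L.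
Proof.
have step : h.+1 ^ (16 * q) <= 2 * h ^ (16 * q).
  have := expn_sub_ge h.+1 1 (16 * q); rewrite subn1 /=.
  have : 2 * (16 * q) < h.+1 by rewrite /h ltnS mulnA.
  move: (16 * q) => a; move: (h.+1 ^ a) (h ^ a) h.+1 => x y H; clear; nia.
rewrite /L expnM [h ^ _]expnM -expnMn.
by case: (m) => // m'; rewrite leq_exp2r.
Qed.

(** By [pow_h] the weights grow by at most 2^m in total, and |C| <= 4^m because |C| is less than
    [Kb * b.+1], with both factors at most 2^m. So B <= 4m, and L = 16qm is chosen to turn this into
    B <= L/(4q). *)
Let often (B : nat) : 2 ^ B * h ^ L <= #|C| * h.+1 ^ L -> 4 * q * B <= L.
Proof.
move=> H; have h0 : 0 < h ^ L by rewrite expn_gt0 /h muln_gt0 q_gt0.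
have {}H : 2 ^ B <= #|C| * 2 ^ m.
  rewrite -(leq_pmul2r h0); apply: leq_trans H _.
  by rewrite -mulnA leq_mul2l pow_h orbT.
have Cm : #|C| <= 2 ^ m * 2 ^ m.
  apply: leq_trans (ltnW C_lt_b) _; apply: leq_mul.
    apply: leq_trans (ltnW (ltn_expl m (ltnSn 1))); move: m_large; clear; lia.
  by apply: leq_trans (ltn_expl m (ltnSn 1)); rewrite ltnS.
have : 2 ^ B <= 2 ^ (4 * m).
  apply: leq_trans H _; apply: leq_trans (_ : 2 ^ m * 2 ^ m * 2 ^ m <= _).
    by rewrite leq_mul2r Cm orbT.
  by rewrite -!expnD leq_exp2l //; clear; lia.
rewrite leq_exp2l // => Bm; rewrite /L [4 * q]mulnC -mulnA [16 * q]mulnC -mulnA leq_mul2l.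
by apply/orP; right; move: Bm; clear; lia.
Qed.

(** Markov's inequality for the number of sparse colours, since |C| < Kb (b+1). *)
Let agood_rare x :
  #|[set w : {ffun 'I_s -> V} | [&& injectiveb w, [forall i, w i != x] &
     b < #|[set c | bad c (x |: [set w i | i : 'I_s])]|]]| * K <= Kb * #|V| ^ s.
Proof.
set W := [set w | _]; rewrite -(leq_pmul2r (ltn0Sn b)) mulnAC.
apply: leq_trans (_ : #|C| * #|V| ^ s <= _); last first.
  by rewrite mulnAC leq_mul2r ltnW ?orbT.
apply: leq_trans (_ : (\sum_(w in W) #|[set c | bad c (x |: [set w i | i :
  'I_s])]|) * K <= _).
  rewrite leq_mul2r -sum_nat_const; apply/orP; right; apply: leq_sum => w.
  by rewrite inE => /and3P[].
under eq_bigr => w _ do rewrite cardsE -sum1_card.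
rewrite (exchange_big_dep predT) //= big_distrl /= -sum_nat_const; apply: leq_sum => c _.
apply: leq_trans (rare c x); rewrite leq_mul2r sum1_card; apply/orP; right.
apply/subset_leq_card/subsetP => w.
by move=> /andP[]; rewrite !inE => /and3P[-> -> _].
Qed.

Lemma vertex_pieces (X : {set V}) : #|X| = s.+1 * N ->
  exists pc : 'I_N -> {set V},
  [/\ forall i, #|pc i| = s.+1 /\ #|[set c | bad c (pc i)]| <= b,
      forall i j, i != j -> [disjoint pc i & pc j], \bigcup_i pc i = X &
      forall c, 4 * q * #|[set i : 'I_N | (i < L) && bad c (pc i)]| <= L].
Proof.
move=> cX.
have N_gt : L < N.
  by move: L_le L_gt0; move: L => A; clear; nia.
have dens : #|V| ^ s <= 2 * (#|X| - s.+1 * L).-1 ^_ s.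
  rewrite cX; apply: expn_le_ffact.
  have NS : 8 * s.+1 <= N.
    by apply: leq_trans N_ge_m; move: m_gt; clear; nia.
  have VN : s.+1 * N <= #|V| by rewrite card_V leq_addr.
  apply: leq_trans VN.
  have : #|V| + s - (s.+1 * N - s.+1 * L).-1 <= 2 * s.+1 + s.+1 * L.
    by move: card_V_lt L_le; rewrite mulnS; clear; lia.
  move: L_le NS; move: (s.+1 * L) (_ - _) => A D; clear; nia.
have [||||||P [P1 P2 P3]] := @reservoir V C X bad s L K b h.
- exact: rare.
- by rewrite cX ltn_mul2l; exact: N_gt.
- exact: dens.
- exact: K_ge.
- apply: leq_trans K_large; rewrite /h /Kb; move: q_gt0; move: q; clear; nia.
- exact: C_gt0.
pose N1 := N - L; pose U := \bigcup_(i < L) P i; pose X' := X :\: U.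
have cU : #|U| = s.+1 * L.
  rewrite -sum1_card partition_disjoint_bigcup => [|i i' ii']; last first.
    by apply: P2; rewrite ?ltn_ord.
  under eq_bigr => i _ do rewrite sum1_card.
  transitivity (\sum_(i < L) s.+1); last by rewrite sum_nat_const card_ord mulnC.
  by apply: eq_bigr => i _; have [] := P1 i (ltn_ord i).
have UX : U \subset X by apply/bigcupsP => i _; have [] := P1 i (ltn_ord i).
have cX' : #|X'| = s.+1 * N1 by rewrite cardsDS // cX cU -mulnBr.
have N1_ge : 2 * s.+1 * s.+1 < N1.
  have SL : L <= s.+1 * L by rewrite leq_pmull.
  have SS : 64 * s.+1 * s.+1 <= N.
    by apply: leq_trans N_ge_m; rewrite leq_mul2l; move: m_gt; clear; lia.
  rewrite /N1 ltn_subRL; move: SL SS L_le; move: (s.+1 * L) L => A B.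
  have : 0 < s.+1 * s.+1 by [].
  by rewrite -!mulnA; move: (s.+1 * s.+1) => D; clear; lia.
have dens' : #|V| ^ s <= 2 * #|X'| ^ s.
  apply: leq_trans dens _; rewrite leq_mul2l /=.
  have -> : #|X| - s.+1 * L = #|X'| by rewrite cardsDS // cU.
  apply: leq_trans (leq_ffact2l s (leq_pred _)) _; exact: ffact_le_expn.
(* The constant exceeds the s+1 rows of a shuffle times the factor 2 lost in [hN1]. Passing from
   samples in V to samples in [X'] costs the other factor 2 in [K_large]. *)
have [||f [f_inj fX' f_ok]] := @perfect_partition V X' s N1 (2 * s.+1).+1
  (fun S => #|[set c | bad c S]| <= b) cX'.
- move=> x _; rewrite -(leq_pmul2l (isT : 0 < 2)); apply: leq_trans dens'.
  rewrite -(leq_pmul2l Kb_gt0); apply: leq_trans (agood_rare x).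
  apply: leq_trans (_ : #|[set w :
    {ffun 'I_s -> V} | [&& injectiveb w, [forall i, w i != x] &
     b < #|[set c | bad c (x |: [set w i | i :
       'I_s])]|]]| * (2 * Kb * (2 * s.+1).+1) <= _); last first.
    by rewrite leq_mul2l K_large orbT.
  rewrite [2 * Kb]mulnC -mulnA [X in _ <= X]mulnCA leq_mul2l; apply/orP; right.
  rewrite [X in _ <= X]mulnCA leq_mul2l; apply/orP; right; rewrite leq_mul2r; apply/orP;
    right.
  apply/subset_leq_card/subsetP => w; rewrite !inE ltnNge.
  by case/and4P=> -> -> _ ->.
- have hN1 : N1 ^ s <= 2 * N1.-1 ^_ s.
    apply: expn_le_ffact; apply: leq_trans (ltnW N1_ge).
    have : N1 + s - N1.-1 <= s.+1 by move: N1_ge; set n := N1; clear; lia.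
    by move: (_ - _) => a; clear; nia.
  have f0 : 0 < N1.-1 ^_ s.
    rewrite ffact_gt0; move: N1_ge; set n := N1; clear; nia.
  rewrite [X in _ < X]mulSn; apply: leq_ltn_trans (_ : s.+1 * (2 * N1.-1 ^_ s) < _).
    by rewrite leq_mul2l hN1 orbT.
  by rewrite mulnA [s.+1 * 2]mulnC -[X in X < _]add0n ltn_add2r.
have j0 : 'I_N1 by apply: (@Ordinal _ 0); move: N1_ge; clear; lia.
pose pc (i : 'I_N) := if i < L then P i else grid_row f (insubd j0 (i - L)).
have pcL (i : 'I_N) : i < L -> pc i = P i by rewrite /pc => ->.
have pcR (i : 'I_N) : ~~ (i < L) -> exists2 j : 'I_N1, val j = i - L & pc i = grid_row f j.
  move=> iL; exists (insubd j0 (i - L)); last by rewrite /pc (negPf iL).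
  by rewrite val_insubd ltn_sub2r // ltnNge -ltnNge N_gt.
have rowX j : grid_row f j \subset X' by apply/subsetP => y /imsetP[a _ ->].
have PX' i j : i < L -> [disjoint P i & grid_row f j].
  move=> iL; rewrite disjoint_sym disjoints_subset; apply: subset_trans (rowX j) _.
  rewrite /X' setDE; apply: subset_trans (subsetIr _ _) _; rewrite setCS.
  exact: (bigcup_sup (Ordinal iL)).
exists pc; split.
- move=> i; have [iL|iL] := boolP (i < L).
    by rewrite pcL //; have [_ cP bP] := P1 i iL.
  have [j _ ->] := pcR i iL; split; last exact: f_ok.
  by rewrite /grid_row card_imset ?card_ord // => a a' /f_inj[].
- move=> i i' ii'; have [iL|iL] := boolP (i < L); have [iL'|iL'] := boolP (i' < L).
  + by rewrite !pcL //; apply: P2.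
  + by rewrite pcL //; have [j _ ->] := pcR i' iL'; apply: PX'.
  + by rewrite (pcL i') // disjoint_sym; have [j _ ->] := pcR i iL; apply: PX'.
  have [j ji ->] := pcR i iL; have [j' ji' ->] := pcR i' iL'.
  rewrite -setI_eq0; apply/eqP/setP => y; rewrite !inE.
  apply/negP => /andP[/imsetP[a _ ->] /imsetP[a' _ /f_inj/(congr1 fst)/= jj]].
  case/eqP: ii'; apply: val_inj; move: ji; rewrite jj ji'.
  move: iL iL'; rewrite /= -!leqNgt; clear=> *; lia.
- have pcX i : pc i \subset X.
    have [iL|iL] := boolP (i < L); first by rewrite pcL //; have [] := P1 i iL.
    by have [j _ ->] := pcR i iL; apply: subset_trans (rowX j) (subsetDl _ _).
  apply/eqP; rewrite eqEsubset; apply/andP; split; first by apply/bigcupsP => i _.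
  apply/subsetP => y yX; have [yU|yU] := boolP (y \in U).
    have /bigcupP[i _ yi] := yU;
      have iN : i < N by apply: leq_trans (ltn_ord i) (ltnW N_gt).
    by apply/bigcupP; exists (Ordinal iN); rewrite // (pcL (Ordinal iN) (ltn_ord i)).
  have : y \in X' by rewrite inE yU.
  have -> : X' = f @: setT.
    apply/esym/eqP; rewrite eqEcard card_imset // cardsT card_prod !card_ord cX' mulnC
      leqnn andbT.
    by apply/subsetP => z /imsetP[p _ ->].
  case/imsetP=> -[j a] _ ->; have jN : L + j < N by have := ltn_ord j;
    rewrite /N1 ltn_subRL.
  apply/bigcupP; exists (Ordinal jN) => //; rewrite /pc /= ltnNge leq_addr /= addKn.
  have -> : insubd j0 (val j) = j by rewrite valKd.
  by apply/imsetP; exists a.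
move=> c; apply: often; apply: leq_trans (P3 c); rewrite leq_mul2r; apply/orP; right.
rewrite leq_exp2l //.
have wi : injective (widen_ord (ltnW N_gt)) by move=> x y /(congr1 val) /= E;
  apply: val_inj.
rewrite -(card_imset _ wi).
apply/subset_leq_card/subsetP => i; rewrite inE => /andP[iL].
rewrite pcL // => bi; apply/imsetP; exists (Ordinal iL); last exact: val_inj.
by rewrite inE.
Qed.

Lemma rainbow_tiled_setT : rainbow_tiled F G setT setT.
Proof.
have [S0 [D0 [cS0 cD0 T0]]] := first_piece.
have cX : #|~: S0| = s.+1 * N by rewrite cardsCs setCK card_V cS0 addnK.
have cCC : #|~: D0| = q * N by rewrite cardsCs setCK card_C cD0 addnK.
have [pc [pcP pc_dis pcX pc_often]] := vertex_pieces cX.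
pose z i := xchoose (enum_onto (proj1 (pcP i))).
have zP i : z i @: setT = pc i by apply/eqP; exact: (xchooseP (enum_onto (proj1 (pcP i)))).
have [||||||D [DP Dmono Ddis DCC]] :=
  @colour_assignment C {set {set 'I_s.+1}} N L q b (~: D0)
  (fun c i => dense (G c) (pc i)) (fun c i => trace G (z i) c).
- exact: q_gt0.
- exact: cCC.
- by move=> i; case: (pcP i).
- exact: pc_often.
- rewrite -/M; have SL : L <= s.+1 * L by rewrite leq_pmull.
  move: SL L_le b_le m_gt N_ge_m;
    have : 64 * m <= 64 * s.+1 * m by rewrite leq_mul2r leq_pmulr ?orbT.
  move: (M * q) (64 * s.+1 * m) (s.+1 * L) L => x y A B; clear; lia.
- rewrite -/M /L; move: b_le m_gt q_gt0; move: (M * q) => x; move: q b m; clear; nia.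
rewrite -(setUCr S0) -(setUCr D0); apply: rainbow_tiledU => //.
- by rewrite disjoints_subset setCK.
- by rewrite disjoints_subset setCK.
rewrite -pcX -DCC; apply: bigcup_tiled => // i.
have [_ cD] := DP i; have [cpc _] := pcP i.
exact: (nearly_mono_tiled (i := i) cpc (zP i) cD (Dmono i)).
Qed.

End Assembly.

(** * Comparison of the thresholds *)

Definition TTil_admissible (R : realType) k d (U : finType) (F : kgraph k U)
    (delta : R) : Prop :=
  (0 <= delta <= 1)%R /\
    forall mu : R, (0 < mu)%R -> exists n0 : nat, forall n : nat,
      n0 <= n ->
      forall (V : finType) (G : 'I_(nedges F * n) -> kgraph k V),
        #|V| = nverts F * n ->
        (forall i, dense_degree d (G i) (delta + mu)%R) ->
        has_transversal_perfect_tiling F G.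

Section Thresholds.
Variables (R : realType) (k d : nat) (VF : finType) (F : kgraph k VF).
Hypotheses (F_nonempty : 0 < nedges F) (d_lt_k : d < k).

Let v_gt0 : 0 < #|VF|. Proof. exact: (VF_gt0 F_nonempty d_lt_k). Qed.

Lemma rainbow_tiled_transversal (V : finType) l (G : 'I_l -> kgraph k V) :
  rainbow_tiled F (fun i => edges (G i)) setT setT -> has_transversal_perfect_tiling F G.
Proof.
have k0 : 0 < k by apply: leq_ltn_trans d_lt_k.
case/(rainbow_tiled_copies k0 (fun i => @edges_uniform k V (G i))) =>
  T [h [Tc Td Tcov [hI hT] hG]].
exists T; first by split=> [K /Tc[]|//|x] //; exact: Tcov.
exists h; split.
- by move=> i j; apply: hI; rewrite inE.
- by rewrite hT; apply/setP => x; apply/imsetP/imsetP => -[i _ ->]; exists i; rewrite ?inE.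
by move=> j; case: (hG j); rewrite ?inE.
Qed.

Lemma TTil_admissible_of (delta : R) :
  Til_admissible d F delta -> CCov_admissible d F delta -> TTil_admissible d F delta.
Proof.
move=> HT HC; split; first by case: HT.
move=> mu mu0; have mu20 : (0 < mu / 2)%R by rewrite divr_gt0.
have /andP[delta0 _] := proj1 HT.
have [t1 Ht1] := mono_rainbow_tiled F_nonempty d_lt_k HT mu20.
have [t2 Ht2] := swap_rainbow_tiled F_nonempty d_lt_k HT HC mu20.
(* [K_large] asks for at most 6144 e^2 s^4, using q <= e(s+1) and s+1 <= 2s. Exponent 5 therefore
   suffices once s >= 6144 e^2, which the choice of [t] guarantees. *)
have [s0 Hs0] := dense_inherit d_lt_k delta0 mu0 5.
pose e := nedges F.
pose t := t1 + t2 + s0 + 6144 * e ^ 2 + 2; pose s := (#|VF| * t).-1.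
have tS : t <= #|VF| * t by rewrite leq_pmull.
have t0 : 0 < t by rewrite /t addn2.
have sS : s.+1 = #|VF| * t by rewrite prednK // (leq_trans t0).
have s_ge : s0 + 6144 * e ^ 2 + 1 <= s.
  by rewrite -ltnS sS; apply: leq_trans tS; rewrite /t; clear; lia.
have [|n1 Hn1] := Hs0 s; first by move: s_ge; clear; lia.
pose q := e * t; pose M := #|{: {set {set 'I_s.+1}}}|.
pose Kb := 64 * s.+1 * q ^ 2; pose m0 := Kb + M * q + s.+1 + 2.
exists (n1 + t * (64 * s.+1 * q * m0)) => n nn V G cV HG.
have v_n : n <= #|V| by rewrite cV leq_pmull.
apply: rainbow_tiled_transversal.
have q0 : 0 < q by rewrite muln_gt0 F_nonempty.
have d0 : 0 < 64 * s.+1 * q by rewrite muln_gt0 q0.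
have HG' i : dense_in k d (edges (G i)) setT (delta + mu)%R.
  by apply/dense_degreeP => //; exact: HG.
have qt : q <= e * s.+1 by rewrite leq_mul2l sS tS orbT.
apply: (@rainbow_tiled_setT k VF F V _ (fun i => edges (G i))
  (fun E S => dense_in k d E S (delta + mu / 2)%R) t s (n %/ t) (n %% t)
  (n %/ t %/ (64 * s.+1 * q)) (s ^ 5)) => //.
- by rewrite ltn_mod.
- by rewrite cV {1}(divn_eq n t) mulnDr sS /nverts; congr (_ + _); clear; lia.
- by rewrite card_ord {1}(divn_eq n t) mulnDr; congr (_ + _); rewrite -/e; clear; lia.
- move=> c S cS Hc r rt; apply: (Ht1 t) => //; last by rewrite cS sS.
    by rewrite /t; clear; lia.
  exact: edges_uniform.
- move=> c0 S c D cS H0 Hc cD cDq HD; apply: (Ht2 t _ V _ _ (edges (G c0))) => //.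
  + by rewrite /t; clear; lia.
  + by move=> i; exact: edges_uniform.
  + exact: edges_uniform.
  + by rewrite cS sS.
- move=> c x; apply: Hn1 => //; first exact: edges_uniform.
  by apply: leq_trans v_n; apply: leq_trans nn; rewrite leq_addr.
- rewrite -/e -/q.
  apply: leq_trans (_ : 2 * (64 * s.+1 * (e * s.+1) ^ 2) * (2 * s.+1).+1 <= _).
    by rewrite leq_mul2r leq_mul2l leq_mul2l leq_exp2r // qt !orbT.
  apply: leq_trans (_ : 2 * (64 * (2 * s) * (e * (2 * s)) ^ 2) * (6 * s) <= _).
    have s1 : s.+1 <= 2 * s by move: s_ge; clear; lia.
    apply: leq_mul; last by move: s_ge; clear; lia.
    rewrite leq_mul2l; apply: leq_mul; first by rewrite leq_mul2l s1 orbT.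
    by rewrite leq_exp2r // leq_mul2l s1 orbT.
  have -> : 2 * (64 * (2 * s) * (e * (2 * s)) ^ 2) * (6 * s) = (6144 * e ^ 2) * s ^ 4 by
    ring.
  by rewrite [s ^ 5]expnS leq_mul2r; apply/orP; right; move: s_ge; clear; lia.
rewrite -/M -/Kb -/q -/m0 leq_divRL // leq_divRL // mulnC [m0 * _]mulnC.
by apply: leq_trans nn; rewrite leq_addl.
Qed.

Lemma Til_of_TTil (delta : R) : TTil_admissible d F delta -> Til_admissible d F delta.
Proof.
case=> d01 H; split=> // mu mu0; have [n0 Hn0] := H mu mu0.
exists (nverts F * n0) => n nn /dvdnP[n' nE] V G cV HG.
have v0 : 0 < nverts F by exact: v_gt0.
have [|||T Tp [e [_ TE eG]]] := Hn0 n' _ V (fun=> G).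
- by move: nn; rewrite nE mulnC leq_pmul2r.
- by rewrite cV nE mulnC.
- by move=> _; exact: HG.
by exists T => //; rewrite TE; apply/subsetP => x /imsetP[i _ ->]; exact: eG.
Qed.

(** One colour [i0] is [G1] and all others are [G2]: the copy containing the edge of colour [i0] is
    a colour covering homomorphism. Fewer than |VF| vertices are dropped first to meet the
    divisibility condition, at a cost of at most mu/2. *)
Lemma CCov_of_TTil (delta : R) : TTil_admissible d F delta -> CCov_admissible d F delta.
Proof.
case=> d01 H; split=> // mu mu0; have mu20 : (0 < mu / 2)%R by rewrite divr_gt0.
have [n0 Hn0] := H (mu / 2)%R mu20; pose v := #|VF|; have v0 : 0 < v := v_gt0.
pose x : R := ((v * (k - d))%:R / (mu / 2))%R.
have x0 : (0 <= x)%R by rewrite divr_ge0 ?ler0n // ltW.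
exists (v * n0.+1 + d + Num.bound x).+1 => n nn V G1 G2 cV H1 H2.
pose n' := n %/ v.
have n'n0 : n0 < n'.
  by rewrite /n' leq_divRL // mulnC; apply: leq_trans (ltnW nn); rewrite -addnA leq_addr.
have [S _ cS] : exists2 S : {set V}, S \subset setT & #|S| = v * n'.
  by apply: subset_of_card; rewrite cardsT cV mulnC leq_trunc_div.
have cSC : #|[set: V] :\: S| < v.
  rewrite cardsDS ?subsetT // cardsT cV cS {1}(divn_eq n v) mulnC addKn ltn_mod //.
have sub (E : kgraph k V) : dense_degree d E (delta + mu)%R ->
    dense_degree d (induced_kgraph S (@edges_uniform _ _ E)) (delta + mu / 2)%R.
  move/(dense_degreeP _ _ d_lt_k) => HE; apply/dense_degreeP => //.
  apply: dense_induced; apply: (dense_in_del (mu :=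
    mu / 2) _ d_lt_k _ _ (subsetT _) _ _ (E := edges E)).
  - exact: edges_uniform.
  - by case/andP: d01 => d0 _; rewrite addr_ge0 // ltW.
  - exact: ltW.
  - by rewrite cardsT cV; move: nn; clear; lia.
  - apply: (@le_trans _ _ (v * (k - d))%:R%R).
      by rewrite ler_nat leq_mul2r ltnW ?orbT.
    rewrite -ler_pdivrMl // mulrC -/x.
    apply: le_trans (ltW (archi_boundP x0)) _; rewrite ler_nat cardsT cV.
    by move: nn; clear; lia.
  by rewrite -addrA -splitr.
have i00 : 0 < nedges F * n' by rewrite muln_gt0 F_nonempty (leq_ltn_trans _ n'n0).
pose i0 : 'I_(nedges F * n') := Ordinal i00.
pose E (i : 'I_(nedges F * n')) := induced_kgraph S
  (@edges_uniform _ _ (if i == i0 then G1 else G2)).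
have [||T [Tc _ _] [h [hI TE hE]]] := Hn0 n' (ltnW n'n0) _ E.
- by rewrite card_induced cS.
- by move=> i; apply: sub; case: ifP.
have /bigcupP[K KT hK] : h i0 \in tiling_edges T by rewrite TE; apply: imset_f.
have [phi [phiI _ K2]] := Tc K KT.
move: hK; rewrite K2 => /imsetP[f fF hf].
exists (val \o phi), f; split=> //.
  by have := hE i0; rewrite inE eqxx hf -imset_comp.
move=> e eD; have {eD} /setD1P[ef eF] : e \in edges F :\ f by [].
have : phi @: e \in tiling_edges T.
  by apply/bigcupP; exists K => //; rewrite K2; apply: imset_f.
rewrite TE => /imsetP[j _ ej]; have := hE j; rewrite inE -ej -imset_comp.
case: eqP => // ji; move: ej; rewrite ji hf => /(imset_inj phiI) E'.
by rewrite E' eqxx in ef.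
Qed.

Lemma dense_degree_le1 (V : finType) (G : kgraph k V) (a : R) :
  k <= #|V| -> dense_degree d G a -> (a <= 1)%R.
Proof.
move=> kV /(dense_degreeP _ _ d_lt_k)/dense_inP H.
have [T TT cT] : exists2 T : {set V}, T \subset setT & #|T| = d.
  by apply: subset_of_card; rewrite cardsT (leq_trans (ltnW d_lt_k)).
have := H T cT TT; rewrite cardsT.
have C0 : (0 < 'C(#|V| - d, k - d)%:R :> R)%R by rewrite ltr0n bin_gt0 leq_sub2r.
move=> le; rewrite -(ler_pM2r C0) mul1r; apply: le_trans le _; rewrite ler_nat.
have := card_between k TT; rewrite cT cardsT; apply: leq_trans.
apply/subset_leq_card/subsetP => e; rewrite !inE => /and3P[eG -> ->].
by rewrite (edges_uniform eG) eqxx.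
Qed.

(** It makes 1 vacuously admissible for tilings and coverings, so that the infima are taken over
    nonempty sets. *)
Lemma one_dense (V : finType) (G : kgraph k V) (mu : R) :
  (0 < mu)%R -> k <= #|V| -> ~ dense_degree d G (1 + mu)%R.
Proof.
move=> mu0 kV /(dense_degree_le1 kV); rewrite -subr_ge0 opprD addrA subrr sub0r oppr_ge0.
by rewrite leNgt mu0.
Qed.

Lemma Til_one : Til_admissible d F (1 : R)%R.
Proof.
split; first by rewrite ler01 lexx.
by move=> mu mu0; exists k => n kn _ V G cV /one_dense[] //; rewrite cV.
Qed.

Lemma CCov_one : CCov_admissible d F (1 : R)%R.
Proof.
split; first by rewrite ler01 lexx.
by move=> mu mu0; exists k => n kn V G1 G2 cV /one_dense[] //; rewrite cV.
Qed.

Lemma TTil_one : TTil_admissible d F (1 : R)%R.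
Proof. exact: (TTil_admissible_of Til_one CCov_one). Qed.

Lemma dense_degree_mono (V : finType) (G : kgraph k V) (a b : R) :
  (a <= b)%R -> dense_degree d G b -> dense_degree d G a.
Proof. by move=> ab; apply: le_trans; rewrite ler_wpM2r ?ler0n. Qed.

Lemma Til_mono (a b : R) : (a <= b)%R -> (b <= 1)%R ->
  Til_admissible d F a -> Til_admissible d F b.
Proof.
move=> ab b1 [/andP[a0 _] H]; split; first by rewrite (le_trans a0 ab).
move=> mu mu0; have [n0 Hn0] := H mu mu0; exists n0 => n nn vn V G cV HG.
by apply: (Hn0 n) => //; apply: dense_degree_mono HG; rewrite lerD2r.
Qed.

Lemma CCov_mono (a b : R) : (a <= b)%R -> (b <= 1)%R ->
  CCov_admissible d F a -> CCov_admissible d F b.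
Proof.
move=> ab b1 [/andP[a0 _] H]; split; first by rewrite (le_trans a0 ab).
move=> mu mu0; have [n0 Hn0] := H mu mu0; exists n0 => n nn V G1 G2 cV H1 H2.
by apply: (Hn0 n) => //; [apply: dense_degree_mono H1|apply: dense_degree_mono H2];
  rewrite lerD2r.
Qed.

End Thresholds.

From mathcomp Require Import all_classical all_reals.

Unset Implicit Arguments.
Local Open Scope ring_scope.

Theorem theorem4p10 (R : realType) (k d : nat) (VF : finType)
    (F : kgraph k VF) (F_nonempty : (0 < nedges F)%N)
    (d_ge1 : (1 <= d)%N) (d_lt_k : (d < k)%N) :
  delta_TTil R d F = Num.max (delta_Til R d F) (delta_CCov R d F).
Proof.
pose TTil := [set x : R | TTil_admissible d F x]%classic.
pose Til := [set x : R | Til_admissible d F x]%classic.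
pose CCov := [set x : R | CCov_admissible d F x]%classic.
have -> : delta_TTil R d F = inf TTil by [].
have -> : delta_Til R d F = inf Til by [].
have -> : delta_CCov R d F = inf CCov by [].
have TTil1 : TTil 1 by exact: TTil_one.
have Til1 : Til 1 by exact: Til_one.
have CCov1 : CCov 1 by exact: CCov_one.
have lbT : has_lbound TTil by exists 0 => x [/andP[]].
have lbTil : has_lbound Til by exists 0 => x [/andP[]].
have lbC : has_lbound CCov by exists 0 => x [/andP[]].
apply/eqP; rewrite eq_le; apply/andP; split; last first.
  rewrite ge_max; apply/andP; split; apply: lb_le_inf; try by exists 1.
    by move=> x Tx; apply: ge_inf => //; exact: Til_of_TTil.
  by move=> x Tx; apply: ge_inf => //; exact: CCov_of_TTil.
(* The infima need not be attained: if both were smaller than [inf TTil], there would be admissible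
   a and b below it, and by monotonicity their maximum would be admissible for both and hence for
   transversal tilings. *)
rewrite leNgt; apply/negP; rewrite gt_max => /andP[ltTil ltC].
have [|a Ta alt] := inf_lt _ ltTil; first by exists 1.
have [|b Cb blt] := inf_lt _ ltC; first by exists 1.
have : TTil (Num.max a b).
  have ab1 : Num.max a b <= 1.
    by case: Ta Cb => /andP[_ a1] _ [/andP[_ b1] _]; rewrite ge_max a1.
  apply: TTil_admissible_of => //.
    by apply: Til_mono Ta; rewrite // le_max lexx.
  by apply: CCov_mono Cb; rewrite // le_max lexx orbT.
by move/(ge_inf lbT); rewrite leNgt gt_max alt blt.
Qed.
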